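(* Let $M_1=\langle(1,2)\rangle$, $M_2=\langle (1,3,2,4),(1,2)\rangle$, and $M_n=\langle x_n,m_n,v_{n-3},\dots,v_0\rangle\le W_n$ for $n\ge3$, where $m_n$ is the element defined in the context. Then for every $n\ge1$ the group $M_n$ satisfies Model 5, i.e. for every partition $\lambda$ of $2^n$ the proportion of elements of $M_n$ with cycle type $\lambda$ equals the density of $\lambda$ in the level $n$ cycle data of Model 5.
   Context: $W_n$ is the automorphism group of the complete binary rooted tree of height $n$, regarded as a permutation group on its $2^n$ leaves labelled $1,\dots,2^n$ from left to right. Permutations are composed right to left. For $i\le n$, $W_i$ is regarded as a subgroup of $W_n$ acting on the leaves $1,\dots,2^i$ and fixing all others. Put $a_i=\prod_{j=1}^{2^{i-1}}(j,\,j+2^{i-1})$, $x_n=a_1a_2\cdots a_n\in W_n$, and $v_i=x_{i+2}^2$ for $i\ge0$. The elements $m_n$. $m_1=\mathrm{id}$. For $n\ge2$, $m_n\in W_n$ is a product of disjoint cycles, each a written sequence carrying a label $nn$ or $sn$: $m_2=(1,2)$ with label $sn$; $m_{n+1}$ is obtained from $m_n$ by replacing each $nn$-labelled cycle $(c_1,\dots,c_k)$ by its standard doubling $(2c_1-1,\dots,2c_k-1,2c_1,\dots,2c_k)$, labelled $nn$, and the unique $sn$-labelled cycle $(c_1,c_2)$ by the product $(2c_1-1,2c_2-1)(2c_1,2c_2)$, the first labelled $nn$ and the second labelled $sn$. The order in which cycles are written is the one produced by this recursion. All other leaves are fixed. E.g. $m_3=(1,3)(2,4)$, $m_4=(1,5,2,6)(3,7)(4,8)$.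 Model 5. Types are $nn,ns,sn,ss$. Level $n$ data is a finite collection of pairs (formal commutative product $\prod_i[t_i,d_i]$ with $t_i$ types and $\sum d_i=2^n$; density). The level 1 data is $([nn,2],\tfrac14),\ ([sn,2],\tfrac14),\ ([nn,1][sn,1],\tfrac18),\ ([ns,1][ss,1],\tfrac18),\ ([nn,1][nn,1],\tfrac1{16}),\ ([ns,1][ns,1],\tfrac1{16}),\ ([sn,1][sn,1],\tfrac1{16}),\ ([ss,1][ss,1],\tfrac1{16})$. Level $n+1$ data is obtained from level $n$ data by replacing, independently, each factor according to: $[nn,d]\to[nn,2d]$; $[ns,d]\to[sn,2d]$; $[sn,d]\to[ns,d][ss,d]$ or $[nn,d][sn,d]$; $[ss,d]\to[nn,d][nn,d]$ or $[ns,d][ns,d]$ or $[sn,d][sn,d]$ or $[ss,d][ss,d]$; alternatives for a given factor are equally likely and densities multiply accordingly. The level $n$ cycle data assigns to each partition $\lambda$ of $2^n$ the sum of the densities of the products whose multiset of $d_i$ is $\lambda$. *)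

(* Defs.v *)
(* Leaves carry the labels 1, ..., 2^n from left to right; label j is the
   ordinal of value j - 1 in 'I_(2 ^ n).  MathComp composes permutations from
   left to right, (s * t) x = t (s x), so a right-to-left product s t is
   written t * s. *)
From HB Require Import structures.
From mathcomp Require Import all_boot all_order all_algebra all_fingroup.

Set Implicit Arguments.
Unset Strict Implicit.
Unset Printing Implicit Defensive.

(* The complete binary rooted tree of height n: the vertex (k, i) is the i-th
   vertex from the left at depth k, and its children are (k + 1, 2 i) and
   (k + 1, 2 i + 1). *)
Definition vertex (n : nat) := {k : 'I_n.+1 & 'I_(2 ^ k)}.

Definition parent (n : nat) (u v : vertex n) : bool :=
  (tag v == (tag u).+1 :> nat) && ((tagged v)./2 == tagged u :> nat).

Definition tree_aut (n : nat) (t : {perm vertex n}) : bool :=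
  [forall u, forall v, parent (t u) (t v) == parent u v].

Definition leaf (n : nat) (x : 'I_(2 ^ n)) : vertex n :=
  Tagged (fun k : 'I_n.+1 => 'I_(2 ^ k)) (x : 'I_(2 ^ (ord_max : 'I_n.+1))).

Definition W_set (n : nat) : {set 'S_(2 ^ n)} :=
  [set s : 'S_(2 ^ n) | [exists t : {perm vertex n},
             tree_aut t && [forall x, t (leaf x) == leaf (s x)]]].

Lemma W_group_set (n : nat) : group_set (W_set n).
Proof.
apply/group_setP; split.
  rewrite inE; apply/existsP; exists 1%g; apply/andP; split.
    by apply/forallP=> u; apply/forallP=> v; rewrite !perm1.
  by apply/forallP=> x; rewrite !perm1.
move=> s1 s2; rewrite !inE => /existsP[t1 /andP[/forallP A1 /forallP L1]].
move=> /existsP[t2 /andP[/forallP A2 /forallP L2]].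
apply/existsP; exists (t1 * t2)%g; apply/andP; split.
  apply/forallP=> u; apply/forallP=> v; rewrite !permM.
  by rewrite (eqP (forallP (A2 _) _)) (eqP (forallP (A1 _) _)).
by apply/forallP=> x; rewrite !permM (eqP (L1 _)) (eqP (L2 _)).
Qed.

Definition W_group (n : nat) : {group 'S_(2 ^ n)} := Group (W_group_set n).

(* The cyclic permutation (c_1, ..., c_k) of the leaves with these labels; it
   fixes every other leaf, since next c j = j when j is not in c.  The defaults
   of insubd are not reached when the labels in c are distinct and lie between
   1 and 2 ^ n; see cycE. *)
Definition cyc (n : nat) (c : seq nat) : 'S_(2 ^ n) :=
  insubd (1%g : 'S_(2 ^ n)) [ffun x : 'I_(2 ^ n) => insubd x (next c x.+1).-1].

Lemma cycE (n : nat) (c : seq nat) (x : 'I_(2 ^ n)) :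
    uniq c -> all (fun j => 0 < j <= 2 ^ n) c ->
  (cyc n c x).+1 = next c x.+1.
Proof.
move=> Uc /allP Bc.
have nextB (y : 'I_(2 ^ n)) : 0 < next c y.+1 <= 2 ^ n.
  case: (boolP (y.+1 \in c)) => [|yc]; first by rewrite -mem_next => /Bc.
  by rewrite next_nth (negbTE yc) ltnS leq0n ltn_ord.
have valE (y : 'I_(2 ^ n)) :
    (insubd y (next c y.+1).-1 : 'I_(2 ^ n)).+1 = next c y.+1.
  have /andP[gt0 le] := nextB y.
  by rewrite val_insubd prednK // le prednK.
have inj : injectiveb [ffun y : 'I_(2 ^ n) => insubd y (next c y.+1).-1].
  apply/injectiveP=> y z; rewrite !ffunE => /(congr1 (fun u : 'I__ => u.+1)).
  rewrite !valE => /(can_inj (prev_next Uc)) [] yz; exact: val_inj.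
by rewrite -valE; congr _.+1; rewrite /cyc unlock /= insubdK //= ffunE.
Qed.

(* As an element of W_N, for i <= N; the factors commute. *)
Definition a_perm (N i : nat) : 'S_(2 ^ N) :=
  (\prod_(1 <= j < (2 ^ i.-1).+1) cyc N [:: j; j + 2 ^ i.-1]%N)%g.

(* x_k = a_1 a_2 ... a_k composed from right to left (a_k acts first), as an
   element of W_N, for k <= N. *)
Definition x_perm (N k : nat) : 'S_(2 ^ N) :=
  (\prod_(i <- rev (index_iota 1 k.+1)) a_perm N i)%g.

Definition v_perm (N i : nat) : 'S_(2 ^ N) := (x_perm N i.+2 ^+ 2)%g.

Inductive ctype := nn | ns | sn | ss.

Definition odds (c : seq nat) : seq nat := [seq j.*2.-1 | j <- c].
Definition evens (c : seq nat) : seq nat := [seq j.*2 | j <- c].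

(* Only the labels nn and sn occur. *)
Definition double_cycle (f : ctype * seq nat) : seq (ctype * seq nat) :=
  match f with
  | (nn, c) => [:: (nn, odds c ++ evens c)]
  | (sn, c) => [:: (nn, odds c); (sn, evens c)]
  | (t, c) => [:: (t, c)]
  end.

Fixpoint m_cycles (n : nat) : seq (ctype * seq nat) :=
  match n with
  | 0 | 1 => [::]
  | 2 => [:: (sn, [:: 1; 2])]
  | n'.+1 => flatten [seq double_cycle f | f <- m_cycles n']
  end.

(* The factors are disjoint cycles, so they commute. *)
Definition m_perm (n : nat) : 'S_(2 ^ n) :=
  (\prod_(f <- m_cycles n) cyc n f.2)%g.

Definition M_gens (n : nat) : {set 'S_(2 ^ n)} :=
  match n with
  | 0 => set0
  | 1 => [set cyc 1 [:: 1; 2]]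
  | 2 => [set cyc 2 [:: 1; 3; 2; 4]; cyc 2 [:: 1; 2]]
  | n'.+3 as k => [set x_perm k k; m_perm k] :|: [set v_perm k (val i) | i : 'I_n'.+1]
  end.

Definition M_group (n : nat) : {group 'S_(2 ^ n)} := <<M_gens n>>%G.

Definition is_partition (N : nat) (la : seq nat) : bool :=
  [&& sorted geq la, all (leq 1) la & sumn la == N].

(* Fixed points count as parts equal to 1. *)
Definition cycle_type (T : finType) (s : {perm T}) : seq nat :=
  sort geq [seq #|C| | C : {set T} <- enum (porbits s)].

(* A list of factors stands for their formal commutative product.  Equal
   products are not merged in the level data: only sums of densities are
   used. *)
Definition factor := (ctype * nat)%type.
Definition datum := (seq factor * rat)%type.

Definition alternatives (f : factor) : seq (seq factor) :=
  let d := f.2 in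
  match f.1 with
  | nn => [:: [:: (nn, d.*2)]]
  | ns => [:: [:: (sn, d.*2)]]
  | sn => [:: [:: (ns, d); (ss, d)]; [:: (nn, d); (sn, d)]]
  | ss => [:: [:: (nn, d); (nn, d)]; [:: (ns, d); (ns, d)];
              [:: (sn, d); (sn, d)]; [:: (ss, d); (ss, d)]]
  end.

Local Open Scope ring_scope.

Definition next_product (p : seq factor) : seq datum :=
  foldr (fun f acc =>
           [seq (alt ++ r.1, (size (alternatives f))%:R^-1 * r.2)
              | alt <- alternatives f, r <- acc])
        [:: ([::], 1)] p.

Definition next_level (D : seq datum) : seq datum :=
  flatten [seq [seq (r.1, pq.2 * r.2) | r <- next_product pq.1] | pq <- D].

Definition model5_level1 : seq datum :=
  [:: ([:: (nn, 2)], 4%:R^-1);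
      ([:: (sn, 2)], 4%:R^-1);
      ([:: (nn, 1); (sn, 1)], 8%:R^-1);
      ([:: (ns, 1); (ss, 1)], 8%:R^-1);
      ([:: (nn, 1); (nn, 1)], 16%:R^-1);
      ([:: (ns, 1); (ns, 1)], 16%:R^-1);
      ([:: (sn, 1); (sn, 1)], 16%:R^-1);
      ([:: (ss, 1); (ss, 1)], 16%:R^-1)]%N.

(* Levels start at 1. *)
Definition model5_level (n : nat) : seq datum := iter n.-1 next_level model5_level1.

Definition model5_density (n : nat) (la : seq nat) : rat :=
  \sum_(pq <- model5_level n | perm_eq [seq f.2 | f <- pq.1] la) pq.2.

Definition proportion (T : finType) (G : {group {perm T}}) (la : seq nat) : rat :=
  #|[set g in G | cycle_type g == la]|%:R / #|G|%:R.

(* Main.v *)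
Require Import Defs.
From HB Require Import structures.
From mathcomp Require Import all_boot all_order all_algebra all_fingroup.
From mathcomp Require Import zify ring.

Set Implicit Arguments.
Unset Strict Implicit.
Unset Printing Implicit Defensive.

(** Read the letters n and s as true and false, so that a type is a pair
    (chi1, chi2) of bits. The group [typed_aut n] of automorphisms of the tree
    of height n that carry types is defined from the root: an element of
    [typed_aut n.+1] is a pair (a, b) of elements of [typed_aut n], acting on
    the two halves of the tree by a and b and then exchanging the halves exactly
    when chi2 a <> chi2 b. Its own type is chi1 = whether the halves are
    exchanged, chi2 = chi1 a + chi1 b. Both are characters, and the order is
    4 ^ (2 ^ n), all four types being equally frequent.

    This recursion is Model 5. If g = (a, b) is uniform in its type class and
    does not exchange the halves, then a and b are independent and uniform, up
    to the constraint that their types add up to the type of g with its letters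
    exchanged: these are the alternatives for sn and ss. If g exchanges the
    halves, its cycles are those of the product a b with lengths doubled, and
    a b is uniform among the elements of the exchanged type: these are the rules
    nn -> nn and ns -> sn. The model replaces factors at the leaves while this
    recursion works at the root; the two agree because the expectation of a
    function of the parts after n steps of the model ([evolve]) is
    multiplicative in the starting product ([evolve_cat]) and compatible with
    doubling all parts ([evolve_double]). Hence [sum_type_cycle_lens].

    It remains to see that M_n is the image of [typed_aut n] in the permutations
    of the leaves ([M_group_image]). The generators lift: x_n to the odometer
    [odo n] = (1, odo), the elements v_i to the squares of smaller odometers in
    the left corner of the tree, and m_n to [m_aut n], which acts on the left
    half as the pair (1, spine), where [spine] = (odo, spine).
    These lifts generate. Indeed, if x = [odo n] and some set Y in the kernel of
    chi2 generate [typed_aut n], then the elements (y, 1) for y in Y, (x^2, 1)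
    and (1, x) generate [typed_aut n.+1] ([gen_step]): conjugating by
    (1, x)^2 = (x, x) produces (k, 1) for every k in the kernel of chi2, and
    these together with (1, x) give everything. Applied to the spine by
    induction, then to (1, spine), then to m_n, this proves [gen_m_aut].

    That m_n acts as [m_aut n] is the last point, since the cycles of m_n are
    defined by refining leaves. Interleaving a cycle with its translate in the
    other half commutes with the doubling of cycles, so the cycles of m_(n+2)
    are the interleaved cycles of the spine ([m_cycles_interleave]), and the
    cycles of the spine satisfy the recursion at the root
    ([spine_cycles_root]). *)

Local Open Scope group_scope.

(** * Groups with two characters, and the twisted square *)

(** Types as values of characters: true and false stand for the letters n and s,
    [chi1] for the first letter and [chi2] for the second. *)
Record tgroup := TGroup {
  tgroup_sort :> finGroupType;
  chi1 : tgroup_sort -> bool;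
  chi2 : tgroup_sort -> bool;
  chi1M : {morph chi1 : g h / g * h >-> g (+) h};
  chi2M : {morph chi2 : g h / g * h >-> g (+) h} }.

Lemma chi1_1 (T : tgroup) : chi1 (1 : T) = false.
Proof. by have := chi1M (1 : T) 1; rewrite mulg1; case: (chi1 _). Qed.

Lemma chi2_1 (T : tgroup) : chi2 (1 : T) = false.
Proof. by have := chi2M (1 : T) 1; rewrite mulg1; case: (chi2 _). Qed.

Lemma chi1V (T : tgroup) (g : T) : chi1 g^-1 = chi1 g.
Proof.
by have := chi1M g g^-1; rewrite mulgV chi1_1; do 2!case: (chi1 _).
Qed.

Lemma chi2V (T : tgroup) (g : T) : chi2 g^-1 = chi2 g.
Proof.
by have := chi2M g g^-1; rewrite mulgV chi2_1; do 2!case: (chi2 _).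
Qed.

Section Base.

(** The tree with one leaf has only the trivial automorphism, but it carries
    each of the four types. *)
Definition klein := (bool * bool)%type.
HB.instance Definition _ := Finite.on klein.

Definition klein_mul (g h : klein) : klein := (g.1 (+) h.1, g.2 (+) h.2).

Lemma klein_mulA : associative klein_mul.
Proof. by move=> [a b] [c d] [e f]; rewrite /klein_mul /= !addbA. Qed.

Lemma klein_mul1 : left_id (false, false) klein_mul.
Proof. by case. Qed.

Lemma klein_mulV : left_inverse (false, false) id klein_mul.
Proof. by case=> a b; rewrite /klein_mul /= !addbb. Qed.

HB.instance Definition _ :=
  Finite_isGroup.Build klein klein_mulA klein_mul1 klein_mulV.

Definition klein_tgroup : tgroup :=
  @TGroup klein fst snd (fun _ _ => erefl) (fun _ _ => erefl).

End Base.

Section Twist.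

Variable T : tgroup.

(** The pair (a, b) stands for the automorphism that acts by a and b on the two
    halves and then exchanges them iff [swaps (a, b)]. No bit records the
    exchange: the relation chi2 a + chi2 b = chi1 (a, b) determines it. *)
Definition twist := (T * T)%type.
HB.instance Definition _ := Finite.on twist.

Implicit Types g h : twist.

Definition swaps g : bool := chi2 g.1 (+) chi2 g.2.

Definition twist_mul g h : twist :=
  if swaps g then (g.1 * h.2, g.2 * h.1) else (g.1 * h.1, g.2 * h.2).

Definition twist_one : twist := (1, 1).

Definition twist_inv g : twist :=
  if swaps g then (g.2^-1, g.1^-1) else (g.1^-1, g.2^-1).

Lemma swapsM g h : swaps (twist_mul g h) = swaps g (+) swaps h.
Proof.
rewrite {1}/swaps /twist_mul; case: ifP => /=; rewrite /swaps !chi2M;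
  by do 4!case: (chi2 _).
Qed.

Lemma twist_mulA : associative twist_mul.
Proof.
move=> f g h; rewrite [LHS]/twist_mul [RHS]/twist_mul swapsM /twist_mul.
by case: (swaps f); case: (swaps g); rewrite /= !mulgA.
Qed.

Lemma twist_mul1 : left_id twist_one twist_mul.
Proof.
by case=> a b; rewrite /twist_mul /swaps /= !chi2_1 /= !mul1g.
Qed.

Lemma twist_mulV : left_inverse twist_one twist_inv twist_mul.
Proof.
move=> g; rewrite /twist_mul.
have -> : swaps (twist_inv g) = swaps g.
  rewrite {1}/swaps /twist_inv; case: ifP => /=; rewrite /swaps !chi2V //.
  by rewrite addbC.
by rewrite /twist_inv; case: (swaps g); rewrite /= !mulVg.
Qed.

HB.instance Definition _ :=
  Finite_isGroup.Build twist twist_mulA twist_mul1 twist_mulV.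

Lemma twist_chi2M : {morph (fun g : twist => chi1 g.1 (+) chi1 g.2) :
  g h / g * h >-> g (+) h}.
Proof.
move=> g h; rewrite {1 2}/mulg /= /twist_mul; case: ifP => _ /=;
  by rewrite !chi1M; do 4!case: (chi1 _).
Qed.

Definition twist_tgroup : tgroup :=
  @TGroup twist swaps (fun g => chi1 g.1 (+) chi1 g.2) swapsM twist_chi2M.

End Twist.

Fixpoint typed_aut (n : nat) : tgroup :=
  if n is n'.+1 then twist_tgroup (typed_aut n') else klein_tgroup.

Definition node n (a b : typed_aut n) : typed_aut n.+1 := (a, b).

Section Node.
Variable n : nat.
Implicit Types a b c d : typed_aut n.

Lemma nodeP (g : typed_aut n.+1) : exists a b, g = node a b.
Proof. by case: g => a b; exists a, b. Qed.

Lemma node_chi1 a b : chi1 (node a b) = chi2 a (+) chi2 b.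
Proof. by []. Qed.

Lemma node_chi2 a b : chi2 (node a b) = chi1 a (+) chi1 b.
Proof. by []. Qed.

Lemma node_mul a b c d : node a b * node c d =
  if chi2 a (+) chi2 b then node (a * d) (b * c) else node (a * c) (b * d).
Proof. by []. Qed.

Lemma node1 : 1 = node (1 : typed_aut n) 1. Proof. by []. Qed.

End Node.

(** Acts on the leaves as x_n; its type is nn. *)
Fixpoint odo n : typed_aut n :=
  if n is n'.+1 then node 1 (odo n') else (true, true).

(** The odometers of heights n - 1, n - 2, ... on the disjoint subtrees hanging
    off the rightmost path; its type is sn. *)
Fixpoint spine n : typed_aut n :=
  if n is n'.+1 then node (odo n') (spine n') else (false, true).

(** The action of m_(n+1) on its left half, with type ns. *)
Definition swap_spine n : typed_aut n :=
  if n is n'.+1 then node 1 (spine n') else (true, false).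

(** A lift of m_n, with type sn. *)
Definition m_aut n : typed_aut n :=
  if n is n'.+1 then node (swap_spine n') 1 else (false, true).

(** Lifts of v_(n-3), ..., v_0, followed by those of the squares of x_1 and
    x_0, which act trivially on the leaves but keep the recursion uniform. *)
Fixpoint corner_squares n : seq (typed_aut n) :=
  if n is n'.+1
  then node (odo n' ^+ 2) 1 :: [seq node v 1 | v <- corner_squares n']
  else [::].

Lemma odo_chi n : (chi1 (odo n) = true) * (chi2 (odo n) = true).
Proof.
elim: n => [|n IH] //; rewrite /odo -/odo node_chi1 node_chi2 !IH.
by rewrite chi1_1 chi2_1.
Qed.

Lemma spine_chi n : (chi1 (spine n) = false) * (chi2 (spine n) = true).
Proof.
elim: n => [|n IH] //; rewrite /spine -/spine node_chi1 node_chi2 !IH.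
by rewrite !odo_chi.
Qed.

Lemma swap_spine_chi n :
  (chi1 (swap_spine n) = true) * (chi2 (swap_spine n) = false).
Proof.
by case: n => [|n] //; rewrite /swap_spine node_chi1 node_chi2 !spine_chi
  chi1_1 chi2_1.
Qed.

Lemma corner_squares_chi n v : v \in corner_squares n ->
  (chi1 v = false) * (chi2 v = false).
Proof.
elim: n v => [|n IH] v //; rewrite [corner_squares _]/= inE =>
  /orP[/eqP->|/mapP[w Vw ->]].
  by rewrite node_chi1 node_chi2 chi1M chi2M !addbb chi1_1 chi2_1.
by rewrite node_chi1 node_chi2 !(IH w Vw) chi1_1 chi2_1.
Qed.

Section Generation.

Variables (n : nat) (x : typed_aut n) (Y : {set typed_aut n}).
Variable H : {group typed_aut n.+1}.
Hypothesis x_chi : chi2 x = true.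
Hypothesis Y_chi : {in Y, forall y, chi2 y = false}.
Hypothesis xY_gen : <<x |: Y>> = [set: typed_aut n].
Hypothesis Hx : node 1 x \in H.
Hypothesis Hx2 : node (x ^+ 2) 1 \in H.
Hypothesis HY : {in Y, forall y, node y 1 \in H}.

(* K is a subgroup normalized by x, because (1, x)^2 = (x, x), and it contains
   x^2; so K and its coset K x cover everything, and K is the kernel of chi2. *)
Let K := [set g : typed_aut n | ~~ chi2 g && (node g 1 \in H)].

Let K_group_set : group_set K.
Proof.
apply/group_setP; split; first by rewrite inE chi2_1 -node1 group1.
move=> g h; rewrite !inE => /andP[/negbTE Cg Hg] /andP[/negbTE Ch Hh].
have := groupM Hg Hh; rewrite node_mul Cg chi2_1 /= mulg1 => ->.
by rewrite chi2M Cg Ch.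
Qed.

Let Kg := Group K_group_set.

Let K_norm g : g \in K -> g ^ x \in K.
Proof.
rewrite !inE => /andP[/negbTE Cg Hg].
have -> : chi2 (g ^ x) = false by rewrite !chi2M chi2V Cg x_chi.
rewrite /=; have := groupJ (groupJ Hg Hx) Hx.
suff -> : (node g 1 ^ node 1 x) ^ node 1 x = node (g ^ x) 1 by [].
rewrite -conjgM node_mul chi2_1 x_chi /= mul1g mulg1.
apply: (mulgI (node x x)); rewrite -(conjgC (node _ 1)).
by rewrite !node_mul Cg chi2_1 !addbb /= mulg1 mul1g conjgC.
Qed.

Let K_cover g : (g \in K) || (g * x^-1 \in K).
Proof.
have x2K : x ^+ 2 \in Kg by rewrite inE Hx2 chi2M addbb.
have xN : <[x]> \subset 'N(Kg).
  by rewrite cycle_subG inE; apply/subsetP=> _ /imsetP[h Kh ->]; apply: K_norm.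
have : g \in Kg <*> <[x]>.
  apply: (subsetP (_ : [set: typed_aut n] \subset _));
    rewrite ?inE // -xY_gen gen_subG.
  apply/subsetP=> y; rewrite !inE => /orP[/eqP->|Yy].
    by rewrite mem_gen // inE cycle_id orbT.
  by rewrite mem_gen // !inE Y_chi // HY.
rewrite norm_joinEr // => /mulsgP[k _ Kk /cycleP[i ->] ->].
rewrite -[i]odd_double_half expgD -mul2n expgM.
have Kk2 : k * (x ^+ 2) ^+ i./2 \in Kg by rewrite groupM // groupX.
have comm j l : x ^+ j * x ^+ l = x ^+ l * x ^+ j by rewrite -!expgD addnC.
case: (odd i); last by rewrite expg0 mul1g Kk2.
by rewrite -expgM comm !mulgA !mulgK expgM Kk2 orbT.
Qed.

(** By [K_cover] the group H contains (c, 1), hence also its conjugate (1, c)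
    under (1, x), for every c in the kernel of chi2. Since chi2 x = 1, dividing by
    (x, x) or (1, x) brings any pair into this case. *)
Lemma gen_step : H = [set: typed_aut n.+1] :> {set typed_aut n.+1}.
Proof.
apply/setP=> g; rewrite inE; have [a [b ->{g}]] := nodeP g.
have KH c : chi2 c = false -> node c 1 \in H.
  move=> Cc; have := K_cover c; rewrite !inE Cc chi2M chi2V Cc.
  by rewrite x_chi /= orbF.
have KH2 c : chi2 c = false -> node 1 c \in H.
  move=> Cc; have := groupJ (KH c Cc) Hx.
  suff -> : node c 1 ^ node 1 x = node 1 c by [].
  apply: (mulgI (node 1 x)); rewrite -(conjgC (node _ 1)).
  by rewrite !node_mul Cc chi2_1 x_chi /= !mul1g !mulg1.
have even c d : chi2 c = false -> chi2 d = false -> node c d \in H.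
  move=> Cc Cd; have := groupM (KH c Cc) (KH2 d Cd).
  by rewrite node_mul Cc chi2_1 /= mul1g mulg1.
have same c d : chi2 c = chi2 d -> node c d \in H.
  case Cd: (chi2 d) => Cc; last exact: even.
  rewrite -[c](mulgKV x) -[d](mulgKV x).
  have -> : node (c * x^-1 * x) (d * x^-1 * x) =
            node (c * x^-1) (d * x^-1) * (node 1 x * node 1 x).
    rewrite (node_mul 1 x 1 x) chi2_1 x_chi /= mul1g mulg1.
    by rewrite node_mul !chi2M Cc Cd addbb.
  by rewrite groupM ?groupM // even // chi2M chi2V x_chi ?Cc ?Cd.
have [Cab|Cab] := eqVneq (chi2 a) (chi2 b); first exact: same.
have Cax : chi2 a = chi2 (b * x^-1).
  by rewrite chi2M chi2V x_chi; case: (chi2 a) (chi2 b) Cab => [] [].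
have -> : node a b = node a (b * x^-1) * node 1 x.
  by rewrite node_mul Cax addbb mulg1 mulgKV.
by rewrite groupM // same.
Qed.

End Generation.

(** Used to exchange the spine for an element of the kernel of chi2, as
    [gen_step] requires. *)
Lemma gen_divr (gT : finGroupType) (x r : gT) (Y : {set gT}) :
  <<x |: (r * x^-1 |: Y)>> = <<x |: (r |: Y)>>.
Proof.
apply/eqP; rewrite eqEsubset !gen_subG !subUset !sub1set.
have sub z : x \in <<x |: (z |: Y)>> /\ z \in <<x |: (z |: Y)>>.
  by rewrite !mem_gen // !inE eqxx ?orbT.
have Ysub z : Y \subset <<x |: (z |: Y)>>.
  by rewrite (subset_trans _ (subset_gen _)) // setUA subsetUr.
have [xr rr] := sub r; have [xd dd] := sub (r * x^-1).
rewrite xr xd !Ysub groupM ?groupV //= andbT.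
by have := groupM dd xd; rewrite mulgKV.
Qed.

Definition gens n (z : typed_aut n) : {set typed_aut n} :=
  odo n |: (z |: [set v in corner_squares n]).

Lemma gen_from_spine n (H : {group typed_aut n.+1}) :
    <<gens (spine n)>> = [set: typed_aut n] ->
    odo n.+1 \in H -> {in corner_squares n.+1, forall v, v \in H} ->
    node (spine n * (odo n)^-1) 1 \in H ->
  H = [set: typed_aut n.+1] :> {set typed_aut n.+1}.
Proof.
move=> gen_n Hx HV Hr.
apply: (@gen_step n (odo n) 
  (spine n * (odo n)^-1 |: [set v in corner_squares n])) => //.
- by rewrite odo_chi.
- move=> y; rewrite !inE => /orP[/eqP->|/corner_squares_chi->//].
  by rewrite chi2M chi2V odo_chi spine_chi.
- by rewrite gen_divr.
- by apply: HV; rewrite inE eqxx.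
- move=> y; rewrite !inE => /orP[/eqP->//|Vy].
  by apply: HV; rewrite in_cons (map_f (fun v => node v 1)) ?orbT.
Qed.

Lemma mem_gens n (z : typed_aut n) (G := <<gens z>>) :
  [/\ odo n \in G, z \in G & {in corner_squares n, forall v, v \in G}].
Proof.
by split=> [||v Vv]; rewrite mem_gen // /gens !in_setU !in_set1 in_set ?Vv
  ?eqxx ?orbT.
Qed.

(** As x = [odo n] has (1, x)^2 = (x, x), dividing (x, r) by it leaves
    (1, r x^-1), which a conjugation moves to the left half. *)
Lemma gen_spine n : <<gens (spine n)>> = [set: typed_aut n].
Proof.
elim: n => [|n IH].
  apply/setP=> g; rewrite [RHS]inE; have [Gx Gr _] := mem_gens (spine 0).
  case: g => [[] []]; [exact: Gx | | exact: Gr | exact: group1].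
  exact: (groupM Gx Gr).
have [Gx Gr GV] := mem_gens (spine n.+1).
apply: (gen_from_spine (H := <<_>>%G) IH Gx GV) => /=.
have -> : node (spine n * (odo n)^-1) 1 =
    odo n.+1 * spine n.+1 * (odo n.+1 * odo n.+1)^-1 * (odo n.+1)^-1.
  apply: (mulIg (odo n.+1)); rewrite mulgKV.
  apply: (mulIg (odo n.+1 * odo n.+1)); rewrite mulgKV.
  rewrite /= !node_mul !chi2M !chi2V !odo_chi !spine_chi !chi2_1 /=.
  by rewrite !(mulg1, mul1g) node_mul !chi2M chi2V odo_chi spine_chi /= mulgKV.
by rewrite !(groupM, groupV).
Qed.

(** The product of (1, x) and (1, r), both exchanging the halves, is (r, x),
    which is (r x^-1, 1) (x, x). *)
Lemma gen_swap_spine n : <<gens (swap_spine n)>> = [set: typed_aut n].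
Proof.
case: n => [|n].
  apply/setP=> g; rewrite [RHS]inE; have [Gx Ga _] := mem_gens (swap_spine 0).
  case: g => [[] []]; [exact: Gx | exact: Ga | | exact: group1].
  exact: (groupM Gx Ga).
have [Gx Ga GV] := mem_gens (swap_spine n.+1).
apply: (gen_from_spine (H := <<_>>%G) (gen_spine n) Gx GV) => /=.
have -> : node (spine n * (odo n)^-1) 1 =
  odo n.+1 * swap_spine n.+1 * (odo n.+1 * odo n.+1)^-1.
  apply: (mulIg (odo n.+1 * odo n.+1)); rewrite mulgKV.
  rewrite /= !node_mul !chi2_1 odo_chi /= !(mulg1, mul1g).
  by rewrite node_mul chi2M chi2V odo_chi spine_chi chi2_1 /= mulgKV mul1g.
by rewrite !(groupM, groupV).
Qed.

(** Here the element (swap_spine, 1) required by [gen_step] is the generator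
    itself. *)
Lemma gen_m_aut n : <<gens (m_aut n)>> = [set: typed_aut n].
Proof.
case: n => [|n]; first exact: gen_spine.
have [Gx Gm GV] := mem_gens (m_aut n.+1).
apply: (@gen_step n (odo n) (swap_spine n |: [set v in corner_squares n])
  <<_>>%G) => //.
- by rewrite odo_chi.
- by move=> y; rewrite !inE => /orP[/eqP->|/corner_squares_chi->//];
  rewrite swap_spine_chi.
- exact: gen_swap_spine.
- by apply: GV; rewrite inE eqxx.
- move=> y; rewrite !inE => /orP[/eqP->|Vy]; first exact: Gm.
  by apply: GV; rewrite in_cons (map_f (fun v => node v 1)) ?orbT.
Qed.

(** * The action on the leaves *)

(** Leaves are numbered from 0, and larger numbers are fixed: this lets
    automorphisms of trees of different heights be compared when the smaller tree
    is the left corner of the larger one. *)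
Fixpoint leaf_act n : typed_aut n -> nat -> nat :=
  match n return typed_aut n -> nat -> nat with
  | 0 => fun _ j => j
  | n'.+1 => fun g j =>
      let: (a, b) := (g : twist (typed_aut n')) in
      if j < 2 ^ n' then chi1 g * 2 ^ n' + leaf_act a j
      else if j < 2 ^ n'.+1 then ~~ chi1 g * 2 ^ n' + leaf_act b (j - 2 ^ n')
      else j
  end%N.

Section Act.
Local Open Scope nat_scope.

Lemma leaf_act_left n (a b : typed_aut n) j : j < 2 ^ n ->
  leaf_act (node a b) j = chi1 (node a b) * 2 ^ n + leaf_act a j.
Proof. by move=> lt_j; rewrite /= lt_j. Qed.

Lemma leaf_act_right n (a b : typed_aut n) j : j < 2 ^ n ->
  leaf_act (node a b) (2 ^ n + j) = ~~ chi1 (node a b) * 2 ^ n + leaf_act b j.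
Proof.
move=> lt_j; rewrite /= expnS mul2n -addnn ltn_add2l lt_j.
by rewrite -{2}[2 ^ n]addn0 ltn_add2l ltn0 addKn.
Qed.

Lemma leaf_act_out n (g : typed_aut n) j : 2 ^ n <= j -> leaf_act g j = j.
Proof.
case: n g => [|n] g //; have [a [b ->{g}]] := nodeP g => le_j.
have le_2n : 2 ^ n <= 2 ^ n.+1 by rewrite leq_exp2l.
by rewrite /= !ltnNge le_j (leq_trans le_2n).
Qed.

Variant leaf_spec n : nat -> bool -> Type :=
  | LeafLeft j of j < 2 ^ n : leaf_spec n j true
  | LeafRight j of j < 2 ^ n : leaf_spec n (2 ^ n + j) true
  | LeafOut j of 2 ^ n.+1 <= j : leaf_spec n j false.

Lemma leafP n j : leaf_spec n j (j < 2 ^ n.+1).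
Proof.
case: ltnP => [|le_j]; last exact: LeafOut.
rewrite expnS mul2n -addnn => lt_j; have [?|le_j] := ltnP j (2 ^ n).
  exact: LeafLeft.
by rewrite -(subnKC le_j); apply: LeafRight; rewrite ltn_subLR.
Qed.

Lemma leaf_act_lt n (g : typed_aut n) j : j < 2 ^ n -> leaf_act g j < 2 ^ n.
Proof.
elim: n g j => [|n IH] g j //; have [a [b ->{g}]] := nodeP g.
have bound (e : bool) k : k < 2 ^ n -> e * 2 ^ n + k < 2 ^ n.+1.
  by rewrite expnS mul2n -addnn; case: e; rewrite ?mul1n ?mul0n; lia.
case: leafP => {}j lt_j // _.
  by rewrite leaf_act_left // bound // IH.
by rewrite leaf_act_right // bound // IH.
Qed.

Lemma leaf_actM n (g h : typed_aut n) j : leaf_act (g * h)%g j =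
  leaf_act h (leaf_act g j).
Proof.
elim: n g h j => [|n IH] g h j //.
have [a [b ->{g}]] := nodeP g; have [c [d ->{h}]] := nodeP h.
case: (leafP n j) => {}j lt_j; last by rewrite !leaf_act_out.
  rewrite [RHS](congr1 _ (leaf_act_left a b lt_j)) node_mul node_chi1.
  case eab: (_ (+) _); rewrite leaf_act_left // !IH node_chi1 !chi2M.
    rewrite mul1n leaf_act_right ?leaf_act_lt // node_chi1.
    by rewrite addbACA [chi2 d (+) _]addbC eab.
  by rewrite mul0n leaf_act_left ?leaf_act_lt // node_chi1 addbACA eab.
rewrite [RHS](congr1 _ (leaf_act_right a b lt_j)) node_mul node_chi1.
case eab: (_ (+) _); rewrite leaf_act_right // !IH node_chi1 !chi2M.
  rewrite mul0n leaf_act_left ?leaf_act_lt // node_chi1.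
  by rewrite addbACA [chi2 d (+) _]addbC eab /= negbK.
by rewrite mul1n leaf_act_right ?leaf_act_lt // node_chi1 addbACA eab.
Qed.

Lemma leaf_act1 n j : leaf_act (1%g : typed_aut n) j = j.
Proof.
elim: n j => [|n IH] j //; rewrite node1.
case: (leafP n j) => {}j lt_j; last by rewrite leaf_act_out.
  by rewrite leaf_act_left // IH node_chi1 addbb.
by rewrite leaf_act_right // IH node_chi1 addbb mul1n.
Qed.

Lemma leaf_actK n (g : typed_aut n) : cancel (leaf_act g) (leaf_act g^-1%g).
Proof. by move=> j; rewrite -leaf_actM mulgV leaf_act1. Qed.

Lemma leaf_act_corner n (a : typed_aut n) j : chi2 a = false ->
  leaf_act (node a 1%g) j = leaf_act a j.
Proof.
move=> Ca; case: (leafP n j) => {}j lt_j.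
- by rewrite leaf_act_left // node_chi1 Ca chi2_1.
- by rewrite leaf_act_right // node_chi1 Ca chi2_1 mul1n leaf_act1 leaf_act_out
  // leq_addr.
- by rewrite !leaf_act_out // (leq_trans _ lt_j) // leq_exp2l.
Qed.

End Act.

Definition leaf_act_ord n (g : typed_aut n) (x : 'I_(2 ^ n)) : 'I_(2 ^ n) :=
  Ordinal (leaf_act_lt g (ltn_ord x)).

Lemma leaf_act_ord_inj n (g : typed_aut n) : injective (leaf_act_ord g).
Proof. by move=> x y [/(can_inj (leaf_actK g)) xy]; apply: val_inj. Qed.

Definition leaf_perm n (g : typed_aut n) : 'S_(2 ^ n) := perm
  (@leaf_act_ord_inj n g).

Lemma leaf_permE n (g : typed_aut n) x : leaf_perm g x = leaf_act g x :> nat.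
Proof. by rewrite permE. Qed.

Lemma leaf_permM n : {in [set: typed_aut n] &,
  {morph @leaf_perm n : g h / g * h}}.
Proof.
by move=> g h _ _; apply/permP=> x; apply: val_inj;
  rewrite permM !permE /= leaf_actM.
Qed.

Canonical leaf_perm_morphism n := Morphism (@leaf_permM n).

Section Blocks.
Local Open Scope nat_scope.

Lemma leaf_act_block n (g : typed_aut n) k x y : k <= n -> x < 2 ^ n ->
  y < 2 ^ n ->
  x %/ 2 ^ k = y %/ 2 ^ k -> leaf_act g x %/ 2 ^ k = leaf_act g y %/ 2 ^ k.
Proof.
elim: n g k x y => [|n IH] g k x y le_k;
  first by rewrite !ltnS !leqn0 => /eqP-> /eqP->.
have [a [b ->{g}]] := nodeP g => lt_x lt_y.
rewrite leq_eqVlt in le_k; case/orP: le_k => [/eqP->|].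
  by rewrite !divn_small // leaf_act_lt.
rewrite ltnS => le_k.
have pk : 0 < 2 ^ k by rewrite expn_gt0.
have shift m z : m * 2 ^ n + z = m * 2 ^ (n - k) * 2 ^ k + z.
  by rewrite -mulnA -expnD subnK.
have shift1 z : 2 ^ n + z = 2 ^ (n - k) * 2 ^ k + z by rewrite -expnD subnK.
have low z : z < 2 ^ n -> z %/ 2 ^ k < 2 ^ (n - k).
  by move=> lt_z; rewrite ltn_divLR // -expnD subnK.
case: (leafP n x) lt_x => {}x lt_x // _; case: (leafP n y) lt_y => {}y lt_y // _.
- by move=> exy; rewrite !leaf_act_left // !shift !divnMDl // (IH a k x y).
- by rewrite shift1 divnMDl // => exy; have := low x lt_x;
  rewrite exy ltnNge leq_addr.
- by rewrite shift1 divnMDl // => exy; have := low y lt_y;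
  rewrite -exy ltnNge leq_addr.
- rewrite !leaf_act_right // !shift1 !shift !divnMDl // => /addnI exy.
  by rewrite (IH b k x y).
Qed.

(** A vertex at depth k is a block of 2 ^ (n - k) consecutive leaves, so a
    permutation of the leaves that respects all these blocks acts on the
    vertices; the first leaf of a block serves to compute the image. *)
Lemma blocks_W n (s : 'S_(2 ^ n)) :
    (forall k (x y : 'I_(2 ^ n)), k <= n ->
       (s x %/ 2 ^ k == s y %/ 2 ^ k) = (x %/ 2 ^ k == y %/ 2 ^ k)) ->
  s \in W_set n.
Proof.
move=> blk.
have first_lt (u : vertex n) : tagged u * 2 ^ (n - tag u) < 2 ^ n.
  have le_k : tag u <= n by rewrite -ltnS.
  have pow : 2 ^ tag u * 2 ^ (n - tag u) = 2 ^ n by rewrite -expnD subnKC.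
  by rewrite -[X in _ < X]pow ltn_pmul2r ?expn_gt0 ?ltn_ord.
pose first_leaf u : 'I_(2 ^ n) := Ordinal (first_lt u).
have img_lt (u : vertex n) : s (first_leaf u) %/ 2 ^ (n - tag u) < 2 ^ tag u.
  have le_k : tag u <= n by rewrite -ltnS.
  by rewrite ltn_divLR ?expn_gt0 // -expnD subnKC.
pose t (u : vertex n) : vertex n :=
  Tagged (fun k : 'I_n.+1 => 'I_(2 ^ k)) (Ordinal (img_lt u)).
have firstK u : first_leaf u %/ 2 ^ (n - tag u) = tagged u.
  by rewrite mulnK ?expn_gt0.
have vertex_eq (u v : vertex n) :
    tag u = tag v -> tagged u = tagged v :> nat -> u = v.
  case: u v => k i [l j] /= ekl; rewrite -{l}ekl in j *.
  by move/val_inj->.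
have t_inj : injective t.
  move=> u v tuv; have ekl : tag u = tag v := congr1 tag tuv.
  have := congr1 (fun w : vertex n => tagged w : nat) tuv.
  rewrite /= ekl => /eqP; rewrite blk ?leq_subr // -{1}ekl !firstK => /eqP.
  exact: vertex_eq.
rewrite inE; apply/existsP; exists (perm t_inj); apply/andP; split; last first.
  apply/forallP=> x; rewrite permE; apply/eqP/vertex_eq => //=.
  rewrite subnn divn1; congr (nat_of_ord (s _)); apply: val_inj => /=.
  by rewrite subnn muln1.
apply/forallP=> u; apply/forallP=> v; rewrite !permE /parent /=; apply/eqP.
case: eqP => //= ekl.
have el : n - tag u = (n - tag v).+1 by rewrite ekl subnSK // -ltnS -ekl ltn_ord.
rewrite -divn2 -divnMA -expnSr -el blk ?leq_subr // firstK el expnSr divnMA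
  firstK.
by rewrite divn2.
Qed.

Lemma leaf_perm_W n (g : typed_aut n) : leaf_perm g \in W_set n.
Proof.
apply: blocks_W => k x y le_k; rewrite !leaf_permE; apply/eqP/eqP;
  last exact: leaf_act_block.
have lt_g (z : 'I_(2 ^ n)) := leaf_act_lt g (ltn_ord z).
by move/(leaf_act_block g^-1%g le_k (lt_g x) (lt_g y)); rewrite !leaf_actK.
Qed.

End Blocks.

(** * Products of disjoint cycles, and the odometer *)

Section Generators.
Local Open Scope nat_scope.

Lemma next_notin (T : eqType) (c : seq T) x : x \notin c -> next c x = x.
Proof. by move=> xc; rewrite next_nth (negbTE xc). Qed.

Definition leaf_label n j := 0 < j <= 2 ^ n.

(** A product of disjoint cycles moves each label within its own cycle, so it is
    known as soon as a function f describes every cycle separately. *)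
Lemma prod_cycE n (cs : seq (seq nat)) (f : nat -> nat) (x : 'I_(2 ^ n)) :
    uniq (flatten cs) -> all (leaf_label n) (flatten cs) ->
    (forall c j, c \in cs -> j \in c -> next c j = f j) ->
    (forall j, j \notin flatten cs -> f j = j) ->
  ((\prod_(c <- cs) cyc n c)%g x).+1 = f x.+1.
Proof.
move=> Ucs Bcs fin fout.
have: if x.+1 \in flatten cs then
        forall c, c \in cs -> x.+1 \in c ->
          ((\prod_(c <- cs) cyc n c)%g x).+1 = next c x.+1
      else (\prod_(c <- cs) cyc n c)%g x = x.
  elim: cs x Ucs Bcs {fin fout} => [|c cs IH] x /=;
    first by rewrite big_nil perm1.
  rewrite cat_uniq all_cat => /and3P[Uc Dc Ucs] /andP[Bc Bcs].
  rewrite big_cons permM mem_cat.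
  have cE := cycE x Uc Bc; have := IH (cyc n c x) Ucs Bcs; rewrite cE.
  case: (boolP (x.+1 \in c)) => [xc | xNc] /=.
    have /negbTE-> : next c x.+1 \notin flatten cs.
      by apply: contra Dc => nc; apply/hasP; exists (next c x.+1);
        rewrite ?mem_next.
    move=> -> d; rewrite inE => /orP[/eqP->|dcs] xd; first exact: cE.
    case/negP: Dc; apply/hasP; exists x.+1 => //.
    by apply/flattenP; exists d.
  have fix_x : cyc n c x = x.
    by apply: val_inj; apply: succn_inj; rewrite cE next_notin.
  rewrite next_notin // fix_x; case: ifP => // _ eq_next d.
  rewrite inE => /orP[/eqP->|]; first by rewrite (negbTE xNc).
  exact: eq_next.
case: ifP => [/flattenP[c cs_c xc]|/negbT/fout -> -> //].
by move=> /(_ c cs_c xc) ->; apply: fin.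
Qed.

(** If g on one half of the tree has the cycle c, then the automorphism that
    carries the left half to the right one by translation and comes back through g
    has the cycle [interleave d c], d being the number of leaves of a half. *)
Definition interleave d (c : seq nat) := flatten [seq [:: j; j + d] | j <- c].

Lemma interleave_cat d c1 c2 :
  interleave d (c1 ++ c2) = interleave d c1 ++ interleave d c2.
Proof. by rewrite /interleave map_cat flatten_cat. Qed.

Lemma perm_interleave d c : perm_eq (interleave d c) (c ++ [seq j + d | j <- c]).
Proof.
elim: c => [|j c IH] //=; rewrite /interleave /= -/(interleave d c) perm_cons.
by rewrite perm_sym -cat1s perm_catCA /= perm_cons perm_sym.
Qed.

Lemma perm_flatten_interleave d (cs : seq (seq nat)) :
  perm_eq (flatten (map (interleave d) cs))
          (flatten cs ++ [seq j + d | j <- flatten cs]).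
Proof.
elim: cs => [|c cs IH] //=; rewrite map_cat.
apply: perm_trans (perm_cat (perm_interleave d c) IH) _.
by rewrite -!catA perm_cat2l perm_catCA.
Qed.

Lemma uniq_interleave d c : uniq c -> all (fun j => 0 < j <= d) c ->
  uniq (interleave d c).
Proof.
move=> Uc /allP Bc; rewrite (perm_uniq (perm_interleave d c)) cat_uniq Uc.
rewrite map_inj_uniq ?Uc ?andbT; last by move=> i j /addIn.
apply/hasPn=> _ /mapP[j /Bc Bj ->]; apply/negP=> /Bc; lia.
Qed.

(** A cycle may be rotated to start at j, where both values are read off. *)
Lemma next_interleave d c j :
    uniq c -> all (fun j => 0 < j <= d) c -> j \in c ->
  (next (interleave d c) j = j + d) * (next (interleave d c) (j + d) = next c j).
Proof.
move=> Uc Bc jc; have Ui := uniq_interleave Uc Bc.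
case/splitPr: {c} jc (jc) Uc Bc Ui => c1 c2 jc Uc /allP/(_ _ jc) Bj Ui.
rewrite -(next_rot (size c1) Uc) rot_size_cat.
have inter_rot k : next (interleave d (c1 ++ j :: c2)) k =
  next (interleave d (j :: c2 ++ c1)) k.
  by rewrite -(next_rot (size (interleave d c1)) Ui) interleave_cat
    rot_size_cat -interleave_cat.
rewrite !inter_rot {inter_rot}.
rewrite /interleave /= -/(interleave d (c2 ++ c1)) eqxx.
have /negbTE-> : j + d != j by lia.
by split=> //; case: (c2 ++ c1) => [|k c]; rewrite /= !eqxx.
Qed.

Lemma perm_double_iota n :
  perm_eq (iota 1 (2 ^ n) ++ [seq j + 2 ^ n | j <- iota 1 (2 ^ n)])
          (iota 1 (2 ^ n.+1)).
Proof.
rewrite expnS mul2n -addnn iotaD perm_cat2l [1 + _]addnC iotaDl.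
by under [X in perm_eq _ X]eq_map do rewrite addnC.
Qed.

Lemma mem_iota_label n j : (j \in iota 1 (2 ^ n)) = leaf_label n j.
Proof. by rewrite mem_iota. Qed.

(** The transpositions that make up a_(i+1) are the one-element cycles of the
    identity of the left half, interleaved. *)
Lemma a_permE N i (x : 'I_(2 ^ N)) : i < N ->
  a_perm N i.+1 x = (if x < 2 ^ i then x + 2 ^ i
                     else if x < 2 ^ i.+1 then x - 2 ^ i else x) :> nat.
Proof.
move=> lt_i; apply: succn_inj.
pose cs := [seq interleave (2 ^ i) [:: j] | j <- iota 1 (2 ^ i)].
have -> : a_perm N i.+1 = (\prod_(c <- cs) cyc N c)%g.
  by rewrite /a_perm big_map /index_iota subn1.
have csE : perm_eq (flatten cs) (iota 1 (2 ^ i.+1)).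
  have -> : cs = map (interleave (2 ^ i)) [seq [:: j] | j <- iota 1 (2 ^ i)].
    by rewrite -map_comp.
  apply: perm_trans (perm_flatten_interleave _ _) _.
  by rewrite flatten_map1 map_id perm_double_iota.
pose f j := if j <= 2 ^ i then j + 2 ^ i else if j <= 2 ^ i.+1 then j - 2 ^ i
  else j.
have le_pow : 2 ^ i.+1 <= 2 ^ N by rewrite leq_exp2l.
have e2 : 2 ^ i.+1 = 2 ^ i + 2 ^ i by rewrite expnS mul2n addnn.
rewrite (@prod_cycE N cs (fun j => if j == 0 then 0 else f j)).
- rewrite /f /=; case: (ltnP x (2 ^ i)) => // le_x.
  by case: ifP => // _; rewrite subSn.
- by rewrite (perm_uniq csE) iota_uniq.
- rewrite (perm_all _ csE); apply/allP=> j; rewrite mem_iota_label /leaf_label.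
  lia.
- move=> _ j /mapP[k k_io ->]; rewrite mem_iota_label in k_io.
  rewrite /f; have nz : 0 < 2 ^ i by rewrite expn_gt0.
  have [n1 n2] : (next (interleave (2 ^ i) [:: k]) k = k + 2 ^ i) *
                 (next (interleave (2 ^ i) [:: k]) (k + 2 ^ i) = next [:: k] k).
    by apply: next_interleave; rewrite ?inE //= andbT.
  move: k_io; rewrite /leaf_label => k_io.
  rewrite !inE => /orP[/eqP->|/eqP->]; rewrite ?n1 ?n2 /= ?eqxx.
    have -> : (k == 0) = false by lia.
    by have -> : k <= 2 ^ i by lia.
  have -> : (k + 2 ^ i == 0) = false by lia.
  have -> : (k + 2 ^ i <= 2 ^ i) = false by lia.
  have -> : (k + 2 ^ i <= 2 ^ i.+1) by lia.
  by rewrite addnK.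
- move=> j; rewrite (perm_mem csE) mem_iota_label /leaf_label /f e2.
  case: eqP => [->//|/eqP]; rewrite -lt0n => -> /=; rewrite -ltnNge => lt_j.
  have lt_ij : 2 ^ i < j := leq_ltn_trans (leq_addr _ _) lt_j.
  by rewrite (leqNgt j (2 ^ i)) lt_ij (leqNgt j (_ + _)) lt_j.
Qed.

Lemma x_permE N k (x : 'I_(2 ^ N)) : k <= N ->
  x_perm N k x = leaf_act (odo k) x :> nat.
Proof.
elim: k x => [|k IH] x le_k.
  by rewrite /x_perm big_nil perm1.
have -> : x_perm N k.+1 = (a_perm N k.+1 * x_perm N k)%g.
  have last_k : index_iota 1 k.+2 = rcons (index_iota 1 k.+1) k.+1.
    by rewrite /index_iota !subn1 -[k.+2.-1]addn1 iotaD cats1 add1n.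
  by rewrite /x_perm last_k rev_rcons big_cons.
rewrite permM IH ?(ltnW le_k) // a_permE //.
case: (leafP k x) => j lt_j.
- by rewrite lt_j leaf_act_out ?leq_addl // leaf_act_left // node_chi1 chi2_1
  odo_chi leaf_act1 addnC mul1n.
- rewrite leaf_act_right // node_chi1 chi2_1 odo_chi /= addKn.
  by rewrite ltnNge leq_addr.
- have lt_kj : 2 ^ k <= j by rewrite (leq_trans _ lt_j) // leq_exp2l.
  by rewrite ltnNge lt_kj !leaf_act_out.
Qed.

Lemma x_perm_odo n : x_perm n n = leaf_perm (odo n).
Proof. by apply/permP=> x; apply: val_inj; rewrite /= leaf_permE x_permE. Qed.

Lemma v_permE N i (x : 'I_(2 ^ N)) : i.+2 <= N ->
  v_perm N i x = leaf_act (odo i.+2 ^+ 2)%g x :> nat.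
Proof.
move=> le_i; rewrite /v_perm !expgS !expg0 !mulg1.
by rewrite permM !x_permE // leaf_actM.
Qed.

(** The single cycle of x_n, written in the order given by the standard
    doubling. *)
Fixpoint odo_cycle n :=
  if n is n'.+1 then odds (odo_cycle n') ++ evens (odo_cycle n') else [:: 1].

Lemma odds_interleave d c : all (leq 1) c ->
  odds (interleave d c) = interleave d.*2 (odds c).
Proof.
elim: c => [|j c IH] //= /andP[j_gt0 c_gt0].
by rewrite /interleave /= -/(interleave d c) -/(interleave _ _) IH //;
  congr [:: _, _ & _]; lia.
Qed.

Lemma evens_interleave d c : evens (interleave d c) = interleave d.*2 (evens c).
Proof.
elim: c => [|j c IH] //=.
by rewrite /interleave /= -/(interleave d c) -/(interleave _ _) IH //;
  congr [:: _, _ & _]; lia.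
Qed.

(** Doubling refines the leaves and interleaving adds a level at the root. As
    the two commute, the cycle obtained by doubling obeys the recursion of the
    odometer at the root. *)
Lemma odo_cycle_interleave n :
  odo_cycle n.+1 = interleave (2 ^ n) (odo_cycle n) /\
  perm_eq (odo_cycle n) (iota 1 (2 ^ n)).
Proof.
elim: n => [|n [IH permX]] //.
have permX1 : perm_eq (odo_cycle n.+1) (iota 1 (2 ^ n.+1)).
  rewrite IH (perm_trans (perm_interleave _ _)) //.
  rewrite (perm_trans _ (perm_double_iota n)) //.
  by apply: perm_cat => //; apply: perm_map.
split=> //; have odo_cycle_gt0 : all (leq 1) (odo_cycle n).
  by rewrite (perm_all _ permX); apply/allP=> j; rewrite mem_iota => /andP[].
rewrite -[LHS]/(odds (odo_cycle n.+1) ++ evens (odo_cycle n.+1)) [in LHS]IH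
  odds_interleave // evens_interleave -interleave_cat.
by rewrite expnS mul2n.
Qed.

(** * The cycles of m_n *)

Definition interleave_cycle d (f : ctype * seq nat) := (f.1, interleave d f.2).
Definition shift_cycle d (f : ctype * seq nat) := (f.1, [seq j + d | j <- f.2]).

Definition double_all fs := flatten [seq double_cycle f | f <- fs].

(** The doubling rule started from the one-leaf tree; the fixed points of the
    spine appear as cycles of length one. *)
Definition spine_cycles n := iter n double_all [:: (sn, [:: 1])].

(** The label 0 is excluded because [odds] truncates it, the labels ns and ss
    because [double_cycle] does not refine them. *)
Definition doublable (f : ctype * seq nat) :=
  all (leq 1) f.2 && (if f.1 is (nn | sn) then true else false).

Lemma double_shift d fs : all doublable fs ->
  double_all (map (shift_cycle d) fs) = map (shift_cycle d.*2) (double_all fs).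
Proof.
have odds_shift c : all (leq 1) c ->
    odds [seq j + d | j <- c] = [seq j + d.*2 | j <- odds c].
  move=> /allP c_gt0; rewrite /odds -!map_comp; apply/eq_in_map=> j /c_gt0 /=;
    lia.
have evens_shift c : evens [seq j + d | j <- c] = [seq j + d.*2 | j <- evens c].
  by rewrite /evens -!map_comp; apply/eq_map=> j /=; lia.
elim: fs => [|[t c] fs IH] //= /andP[/andP[/= c_gt0 tP] {}/IH IH].
rewrite /double_all /= in IH *; rewrite IH map_cat; congr (_ ++ _).
case: t tP => //= _; rewrite /shift_cycle /= ?map_cat odds_shift ?evens_shift //.
Qed.

Lemma double_interleave d fs : all doublable fs ->
  double_all (map (interleave_cycle d) fs) =
    map (interleave_cycle d.*2) (double_all fs).
Proof.
elim: fs => [|[t c] fs IH] //= /andP[/andP[/= c_gt0 tP] {}/IH IH].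
rewrite /double_all /= in IH *; rewrite IH map_cat; congr (_ ++ _).
case: t tP => //= _; rewrite /interleave_cycle /= odds_interleave
  ?evens_interleave //.
by rewrite -interleave_cat.
Qed.

Lemma odo_cycle_iota n : perm_eq (odo_cycle n) (iota 1 (2 ^ n)).
Proof. by case: (odo_cycle_interleave n). Qed.

Lemma odo_cycle_gt0 n : all (leq 1) (odo_cycle n).
Proof.
rewrite (perm_all _ (odo_cycle_iota n)); apply/allP=> j.
by rewrite mem_iota => /andP[].
Qed.

(** The sn-labelled cycle of [spine_cycles n] splits off an nn-labelled cycle at
    every step. The one split off first has by then grown into [odo_cycle n],
    and the others descend from the right one of the two leaves of height 1. *)
Lemma spine_cycles_root n :
  spine_cycles n.+1 =
    (nn, odo_cycle n) :: map (shift_cycle (2 ^ n)) (spine_cycles n) /\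
  all doublable (spine_cycles n).
Proof.
elim: n => [|n [IH Rn]] //.
have Rn1 : all doublable (spine_cycles n.+1).
  rewrite IH /= {1}/doublable /= odo_cycle_gt0 /= all_map.
  apply: sub_all Rn => -[t c] /andP[/allP c_gt0 tP];
    rewrite /doublable /= tP andbT.
  by rewrite all_map; apply/allP=> j /c_gt0 /=; lia.
split=> //; rewrite -[LHS]/(double_all (spine_cycles n.+1)) [in LHS]IH.
rewrite -[LHS]/((nn, odo_cycle n.+1) ::
                double_all (map (shift_cycle (2 ^ n)) (spine_cycles n))).
by rewrite double_shift // expnS mul2n.
Qed.

Definition supports (fs : seq (ctype * seq nat)) := [seq f.2 | f <- fs].

Lemma supports_shift d fs :
  supports (map (shift_cycle d) fs) =
    [seq [seq j + d | j <- c] | c <- supports fs].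
Proof. by rewrite /supports -!map_comp. Qed.

Lemma spine_cycles_iota n :
  perm_eq (flatten (supports (spine_cycles n))) (iota 1 (2 ^ n)).
Proof.
elim: n => [|n IH] //; have [-> _] := spine_cycles_root n.
rewrite (perm_trans _ (perm_double_iota n)) //= perm_cat ?odo_cycle_iota //.
by rewrite supports_shift -map_flatten perm_map.
Qed.

(** Both sides obey the same doubling rule, and they agree at n = 0, where the
    cycle (1, 2) is the interleaved fixed point of the one-leaf tree. *)
Lemma m_cycles_interleave n :
  m_cycles n.+2 = map (interleave_cycle (2 ^ n)) (spine_cycles n).
Proof.
elim: n => [|n IH] //.
rewrite -[LHS]/(double_all (m_cycles n.+2)) IH double_interleave ?expnS ?mul2n //.
by case: (spine_cycles_root n).
Qed.

(** Labels start at 1. *)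
Definition label_act n (g : typed_aut n) j := (leaf_act g j.-1).+1.

Definition follows n (g : typed_aut n) (c : seq nat) :=
  {in c, next c =1 label_act g}.

Lemma follows_interleave n (g : typed_aut n) c : chi2 g ->
    uniq c -> all (leaf_label n) c -> follows g c ->
  follows (node 1%g g) (interleave (2 ^ n) c).
Proof.
move=> Cg Uc Bc fc j; rewrite (perm_mem (perm_interleave _ _)) mem_cat.
have pred_lt k : k \in c -> 0 < k /\ k.-1 < 2 ^ n.
  by move=> /(allP Bc) /andP[k_gt0 le_k]; rewrite prednK.
case/orP=> [jc|/mapP[k kc ->{j}]].
  have [j_gt0 lt_j] := pred_lt j jc; rewrite (next_interleave Uc Bc jc).1.
  by rewrite /label_act leaf_act_left // node_chi1 chi2_1 Cg leaf_act1 mul1n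
    -addnS prednK // addnC.
have [k_gt0 lt_k] := pred_lt k kc; rewrite (next_interleave Uc Bc kc).2 fc //.
have -> : k + 2 ^ n = (2 ^ n + k.-1).+1 by rewrite -addnS prednK // addnC.
by rewrite /label_act leaf_act_right // node_chi1 chi2_1 Cg.
Qed.

Lemma follows_left n (a b : typed_aut n) c : chi2 a = chi2 b ->
  all (leaf_label n) c -> follows a c -> follows (node a b) c.
Proof.
move=> Cab /allP Bc fc j jc; have /andP[j_gt0 le_j] := Bc j jc.
by rewrite fc // /label_act leaf_act_left ?prednK // node_chi1 Cab addbb.
Qed.

Lemma follows_right n (a b : typed_aut n) c : chi2 a = chi2 b ->
    uniq c -> all (leaf_label n) c -> follows b c ->
  follows (node a b) [seq j + 2 ^ n | j <- c].
Proof.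
move=> Cab Uc /allP Bc fc _ /mapP[j jc ->]; have /andP[j_gt0 le_j] := Bc j jc.
rewrite (@next_map _ _ (addn^~ (2 ^ n))) //; last exact: addIn.
have -> : j + 2 ^ n = (2 ^ n + j.-1).+1 by rewrite -addnS prednK // addnC.
rewrite /label_act leaf_act_right ?prednK // node_chi1 Cab addbb mul1n fc //.
by rewrite addnC -addnS.
Qed.

Lemma odo_cycle_label n : uniq (odo_cycle n) /\ all (leaf_label n) (odo_cycle n).
Proof.
have c_iota := odo_cycle_iota n.
rewrite (perm_uniq c_iota) iota_uniq (perm_all _ c_iota); split=> //.
by apply/allP=> j; rewrite mem_iota_label.
Qed.

Lemma follows_odo_cycle n : follows (odo n) (odo_cycle n).
Proof.
elim: n => [|n IH]; first by move=> j; rewrite inE => /eqP->.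
have [-> _] := odo_cycle_interleave n; have [UX BX] := odo_cycle_label n.
by apply: follows_interleave; rewrite ?odo_chi.
Qed.

Lemma spine_cycles_label n c : c \in supports (spine_cycles n) ->
  uniq c /\ all (leaf_label n) c.
Proof.
move=> Rc; split; last first.
  apply/allP=> j jc; rewrite -mem_iota_label -(perm_mem (spine_cycles_iota n)).
  by apply/flattenP; exists c.
have : uniq (flatten (supports (spine_cycles n))).
  by rewrite (perm_uniq (spine_cycles_iota n)) iota_uniq.
elim: (supports (spine_cycles n)) Rc => //= d s IH.
rewrite inE cat_uniq => /orP[/eqP->|sc] /and3P[Ud _ Us] //; exact: IH.
Qed.

Lemma follows_spine_cycles n c : c \in supports (spine_cycles n) ->
  follows (spine n) c.
Proof.
elim: n c => [|n IH] c; first by rewrite inE => /eqP-> j; rewrite inE => /eqP->.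
have [-> _] := spine_cycles_root n.
have Cxr : chi2 (odo n) = chi2 (spine n) by rewrite odo_chi spine_chi.
rewrite /= supports_shift in_cons => /orP[/eqP->|/mapP[d Rd ->]].
  by have [_ BX] := odo_cycle_label n; apply: follows_left => //;
    apply: follows_odo_cycle.
by have [Ud Bd] := spine_cycles_label Rd; apply: follows_right => //; apply: IH.
Qed.

(** The interleaved cycles of the spine cover the left half and follow
    [swap_spine]; the right half is fixed. *)
Lemma m_perm_aut n : m_perm n.+2 = leaf_perm (m_aut n.+2).
Proof.
have Ca : chi2 (swap_spine n.+1) = false by rewrite swap_spine_chi.
apply/permP=> x; apply: val_inj; rewrite /= leaf_permE leaf_act_corner //;
  apply: succn_inj.
rewrite /m_perm m_cycles_interleave big_map.
pose cs := map (interleave (2 ^ n)) (supports (spine_cycles n)).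
have csE : perm_eq (flatten cs) (iota 1 (2 ^ n.+1)).
  rewrite (perm_trans (perm_flatten_interleave _ _)) //.
  rewrite (perm_trans _ (perm_double_iota n)) //.
  by apply: perm_cat; rewrite ?perm_map ?spine_cycles_iota.
have -> : (\prod_(f <- spine_cycles n) cyc n.+2 (interleave_cycle (2 ^ n) f).2 =
           \prod_(c <- cs) cyc n.+2 c)%g by rewrite !big_map.
pose f j := if j == 0 then 0 else label_act (swap_spine n.+1) j.
rewrite (@prod_cycE _ cs f) // /f.
- by rewrite (perm_uniq csE) iota_uniq.
- rewrite (perm_all _ csE); apply/allP=> j; rewrite mem_iota_label /leaf_label.
  by case/andP=> -> le_j; rewrite (leq_trans le_j) // leq_exp2l.
- move=> _ j /mapP[c Rc ->] jc; have [Uc Bc] := spine_cycles_label Rc.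
  have -> : (j == 0) = false.
    apply/negbTE; rewrite -lt0n; suff: leaf_label n.+1 j by case/andP.
    rewrite -mem_iota_label -(perm_mem csE).
    by apply/flattenP; exists (interleave (2 ^ n) c); rewrite ?map_f.
  apply: (@follows_interleave n (spine n) c) => //; first by rewrite spine_chi.
  exact: follows_spine_cycles.
- move=> j; rewrite (perm_mem csE) mem_iota_label /leaf_label.
  case: eqP => [->|/eqP] //; rewrite -lt0n => j_gt0;
    rewrite j_gt0 /= -ltnNge => lt_j.
  by rewrite /label_act leaf_act_out ?prednK // -ltnS prednK.
Qed.

Lemma cyc_odo_cycle n : cyc n (odo_cycle n) = leaf_perm (odo n).
Proof.
have [UX BX] := odo_cycle_label n.
apply/permP=> x; apply: val_inj; rewrite /= leaf_permE; apply: succn_inj.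
rewrite cycE // follows_odo_cycle // (perm_mem (odo_cycle_iota n)) mem_iota_label.
by rewrite /leaf_label /= ltn_ord.
Qed.

(** * The group M_n as an image *)

Lemma corner_square_act n v : v \in corner_squares n ->
  exists2 k, k < n & leaf_act v =1 leaf_act (odo k ^+ 2)%g.
Proof.
elim: n v => [|n IH] v //; rewrite [corner_squares _]/= in_cons =>
  /orP[/eqP->|/mapP[w Vw ->]].
  by exists n => // j; rewrite leaf_act_corner // chi2M addbb.
have [k lt_k wE] := IH w Vw; exists k; first exact: ltnW.
by move=> j; rewrite leaf_act_corner ?wE // (corner_squares_chi Vw).
Qed.

Lemma act_corner_square n k : k < n ->
  exists2 v, v \in corner_squares n & leaf_act v =1 leaf_act (odo k ^+ 2)%g.
Proof.
elim: n => [|n IH] //; rewrite ltnS leq_eqVlt => /orP[/eqP->|/IH[w Vw wE]].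
  exists (node (odo n ^+ 2)%g 1%g) => [|j]; first exact: mem_head.
  by rewrite leaf_act_corner // chi2M addbb.
exists (node w 1%g) => [|j]; last first.
  by rewrite leaf_act_corner ?wE // (corner_squares_chi Vw).
by rewrite [corner_squares _]/= in_cons (map_f (fun v => node v 1%g)) ?orbT.
Qed.

Lemma leaf_act_odo_sqr k j : k < 2 -> leaf_act (odo k ^+ 2)%g j = j.
Proof.
case: k => [|[|k]] // _; rewrite expgS expg1 leaf_actM.
by case: j => [|[|j]].
Qed.

Lemma leaf_perm_id n (g : typed_aut n) : leaf_act g =1 id -> leaf_perm g = 1%g.
Proof.
by move=> g1; apply/permP=> x; apply: val_inj; rewrite /= leaf_permE g1 perm1.
Qed.

Lemma v_perm_corner n i v : i.+2 <= n ->
  leaf_act v =1 leaf_act (odo i.+2 ^+ 2)%g ->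
  v_perm n i = leaf_perm (v : typed_aut n).
Proof.
by move=> lt_i vE; apply/permP=> x; apply: val_inj;
  rewrite /= leaf_permE vE v_permE.
Qed.

Lemma M_group_image n : 0 < n ->
  M_group n = @leaf_perm n @* [set: typed_aut n] :> {set _}.
Proof.
move=> n_gt0.
have image g : leaf_perm g \in @leaf_perm n @* [set: typed_aut n].
  by rewrite mem_morphim ?inE.
have sub (G : {group 'S_(2 ^ n)}) :
    leaf_perm (odo n) \in G -> leaf_perm (m_aut n) \in G ->
    (forall i, i.+2 < n -> v_perm n i \in G) ->
  @leaf_perm n @* [set: typed_aut n] \subset G.
  move=> Gx Gm Gv.
  have -> : @leaf_perm n @* [set: typed_aut n] =
      <<@leaf_perm n @* gens (m_aut n)>>.
    by rewrite -morphim_gen ?subsetT // gen_m_aut.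
  rewrite gen_subG.
  apply/subsetP=> _ /morphimP[g _ Yg ->] /=; move: Yg.
  rewrite /gens !in_setU !in_set1 in_set => /or3P[/eqP->|/eqP->|Vg] //.
  have [[|[|i]] lt_i gE] := corner_square_act Vg.
  - by rewrite leaf_perm_id ?group1 // => j; rewrite gE leaf_act_odo_sqr.
  - by rewrite leaf_perm_id ?group1 // => j; rewrite gE leaf_act_odo_sqr.
  - by rewrite -(v_perm_corner (ltnW lt_i) gE) Gv.
apply/eqP; rewrite eqEsubset gen_subG; apply/andP; split.
  case: n n_gt0 image {sub} => [|[|[|n]]] // _ image.
  - by rewrite sub1set (cyc_odo_cycle 1) image.
  - have m2 : cyc 2 [:: 1; 2] = leaf_perm (m_aut 2).
      by rewrite -m_perm_aut /m_perm big_seq1.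
    by rewrite subUset !sub1set (cyc_odo_cycle 2) m2 !image.
  rewrite !subUset !sub1set x_perm_odo m_perm_aut !image.
  apply/subsetP=> _ /imsetP[i _ ->].
  have [v _ vE] : exists2 v, v \in corner_squares n.+3 &
    leaf_act v =1 leaf_act (odo i.+2 ^+ 2)%g.
    by apply: act_corner_square; rewrite !ltnS -ltnS ltn_ord.
  by rewrite (v_perm_corner _ vE) ?image // !ltnS ltnW.
apply: sub.
- case: n n_gt0 {image} => [|[|[|n]]] // _; rewrite mem_gen //.
  + by rewrite -cyc_odo_cycle !inE.
  + by rewrite -cyc_odo_cycle !inE eqxx.
  + by rewrite !inE x_perm_odo eqxx.
- case: n n_gt0 {image} => [|[|n]] // _.
    by rewrite leaf_perm_id ?group1 // => -[|[|j]].
  rewrite mem_gen // -m_perm_aut.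
  case: n => [|n]; last by rewrite !inE eqxx orbT.
  by rewrite /m_perm big_seq1 !inE eqxx orbT.
- case: n n_gt0 {image} => [|[|[|n]]] // _ i; rewrite !ltnS => lt_i.
  rewrite mem_gen // in_setU orbC (_ : v_perm _ _ \in _) //.
  by apply/imsetP; exists (Ordinal (lt_i : i < n.+1)).
Qed.

End Generators.

(** * Cycle lengths of a tree automorphism *)

Definition cycle_lens (T : finType) (s : {perm T}) : seq nat :=
  [seq #|C| | C : {set T} <- enum (porbits s)].

Section Glue.

(* f0 and f1 embed T as the two halves of U. *)
Variables (T U : finType) (f0 f1 : T -> U) (s : {perm U}) (s0 s1 : {perm T}).
Hypotheses (f0_inj : injective f0) (f1_inj : injective f1).
Hypothesis f01 : forall x y, f0 x != f1 y.
Hypothesis fcover : forall u, (exists x, u = f0 x) \/ (exists x, u = f1 x).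

Let porbit_mono (f : T -> U) (r : {perm U}) (r' : {perm T}) x :
  (forall y, r (f y) = f (r' y)) -> porbit r (f x) = f @: porbit r' x.
Proof.
move=> rf; have powE i y : (r ^+ i) (f y) = f ((r' ^+ i) y).
  by elim: i y => [|i IH] y; rewrite ?expg0 ?perm1 // !expgS !permM rf IH.
apply/setP=> u; apply/porbitP/imsetP=> [[i ->]|[y /porbitP[i ->] ->]].
  by exists ((r' ^+ i) x); rewrite ?powE // mem_porbit.
by exists i; rewrite powE.
Qed.

Let imset_f0f1 (A B : {set T}) : f0 @: A = f1 @: B -> A = set0.
Proof.
move=> eAB; apply/eqP/set0Pn=> -[x xA].
have : f0 x \in f1 @: B by rewrite -eAB imset_f.
by case/imsetP=> y _ /eqP; rewrite (negbTE (f01 x y)).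
Qed.

(** If s preserves both halves, its orbits are those of s0 and of s1. *)
Lemma cycle_lens_split : (forall x, s (f0 x) = f0 (s0 x)) ->
    (forall x, s (f1 x) = f1 (s1 x)) ->
  perm_eq (cycle_lens s) (cycle_lens s0 ++ cycle_lens s1).
Proof.
move=> sf0 sf1.
have lensE (f : T -> U) (r : {perm T}) : injective f ->
    cycle_lens r = [seq #|C| | C : {set U} <-
                      [seq f @: C | C : {set T} <- enum (porbits r)]].
  by move=> f_inj; rewrite -map_comp; apply: eq_map => C /=; rewrite card_imset.
rewrite (lensE f0 s0) // (lensE f1 s1) // -map_cat; apply: perm_map.
apply: uniq_perm; first exact: enum_uniq.
  rewrite cat_uniq !map_inj_uniq ?enum_uniq //; try exact: imset_inj.
  rewrite andbT; apply/hasPn=> _ /mapP[C Cs ->]; apply/negP=> /mapP[D Ds eCD].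
  have D0 := imset_f0f1 (esym eCD); move: Ds; rewrite mem_enum D0.
  by case/imsetP=> x _ /setP/(_ x); rewrite inE porbit_id.
move=> C; rewrite mem_enum mem_cat; apply/imsetP/orP=> [[u _ ->]|].
  case: (fcover u) => -[x ->].
    by left; rewrite (porbit_mono _ sf0) map_f // mem_enum imset_f.
  by right; rewrite (porbit_mono _ sf1) map_f // mem_enum imset_f.
case=> /mapP[D + ->]; rewrite mem_enum => /imsetP[x _ ->].
  by exists (f0 x); rewrite // (porbit_mono _ sf0).
by exists (f1 x); rewrite // (porbit_mono _ sf1).
Qed.

(** If s exchanges the halves, every orbit of s meets the first half in an orbit
    of s0 s1, of half its size. *)
Lemma cycle_lens_double : (forall x, s (f0 x) = f1 (s0 x)) ->
    (forall x, s (f1 x) = f0 (s1 x)) ->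
  perm_eq (cycle_lens s) (map double (cycle_lens (s0 * s1))).
Proof.
move=> sf0 sf1; set r := s0 * s1.
pose lift (C : {set T}) := f0 @: C :|: f1 @: (s0 @: C).
have memf0 C x : (f0 x \in lift C) = (x \in C).
  rewrite inE mem_imset //; case: (x \in C) => //=.
  by apply/imsetP=> -[y _ /eqP]; rewrite (negbTE (f01 _ _)).
have lift_inj : injective lift.
  by move=> C D eCD; apply/setP=> x; rewrite -!memf0 eCD.
have lift_card C : #|lift C| = #|C|.*2.
  rewrite cardsU !card_imset //; last exact: perm_inj.
  rewrite (_ : _ :&: _ = set0) ?cards0 ?subn0 ?addnn //.
  apply/setP=> u; rewrite !inE; apply/negP=> /andP[/imsetP[x _ ->] /imsetP[y _
    /eqP]].
  by rewrite (negbTE (f01 _ _)).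
have powE i x : (s ^+ i.*2) (f0 x) = f0 ((r ^+ i) x).
  elim: i x => [|i IH] x; first by rewrite expg0 !perm1.
  by rewrite doubleS !expgS !permM sf0 sf1 IH.
have orbitE x : porbit s (f0 x) = lift (porbit r x).
  apply/setP=> u; rewrite inE; apply/porbitP/orP=> [[i ->]|].
    rewrite -[i]odd_double_half addnC; case: (odd i).
      rewrite addn1 expgSr permM powE sf0; right.
      by rewrite !imset_f // mem_porbit.
    by rewrite addn0 powE; left; rewrite imset_f // mem_porbit.
  case=> [/imsetP[y /porbitP[i ->] ->]|/imsetP[y /imsetP[z /porbitP[i ->] ->]
    ->]].
    by exists i.*2; rewrite powE.
  by exists i.*2.+1; rewrite expgSr permM powE sf0.
have -> : map double (cycle_lens r) =
  [seq #|C| | C : {set U} <- map lift (enum (porbits r))].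
  by rewrite -!map_comp; apply: eq_map => C /=; rewrite lift_card.
apply: perm_map; apply: uniq_perm; rewrite ?map_inj_uniq ?enum_uniq //.
move=> C; rewrite mem_enum; apply/imsetP/mapP=> [[u _ ->]|[D + ->]].
  suff [x ->] : exists x, porbit s u = porbit s (f0 x).
    by exists (porbit r x); rewrite ?orbitE // mem_enum imset_f.
  case: (fcover u) => -[x ->]; first by exists x.
  exists (s1 x); apply/eqP; rewrite eq_porbit_mem -sf1.
  by rewrite porbit_sym (mem_porbit s 1).
by rewrite mem_enum => /imsetP[x _ ->]; exists (f0 x); rewrite ?orbitE.
Qed.

End Glue.

Section Leaves.
Variable n : nat.
Local Open Scope nat_scope.

Lemma lo_lt (x : 'I_(2 ^ n)) : x < 2 ^ n.+1.
Proof. by rewrite (leq_trans (ltn_ord x)) // leq_exp2l. Qed.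

Lemma hi_lt (x : 'I_(2 ^ n)) : 2 ^ n + x < 2 ^ n.+1.
Proof. by rewrite expnS mul2n -addnn ltn_add2l ltn_ord. Qed.

Definition lo x : 'I_(2 ^ n.+1) := Ordinal (lo_lt x).
Definition hi x : 'I_(2 ^ n.+1) := Ordinal (hi_lt x).

Lemma lo_inj : injective lo. Proof. by move=> x y [/val_inj]. Qed.
Lemma hi_inj : injective hi. Proof. by move=> x y [/addnI/val_inj]. Qed.

Lemma lo_hi x y : lo x != hi y.
Proof. by rewrite -val_eqE /= ltn_eqF // (leq_trans (ltn_ord x)) // leq_addr. Qed.

Lemma lo_hi_cover u : (exists x, u = lo x) \/ (exists x, u = hi x).
Proof.
case: u => j lt_j; have [lt_jn|le_nj] := ltnP j (2 ^ n).
  by left; exists (Ordinal lt_jn); apply: val_inj.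
have lt_jn : j - 2 ^ n < 2 ^ n by rewrite ltn_subLR // addnn -mul2n -expnS.
by right; exists (Ordinal lt_jn); apply: val_inj; rewrite /= subnKC.
Qed.

Variables a b : typed_aut n.

Lemma cycle_lens_node_fix : chi2 a = chi2 b ->
  perm_eq (cycle_lens (leaf_perm (node a b))) (cycle_lens (leaf_perm a) ++
    cycle_lens (leaf_perm b)).
Proof.
move=> Cab; apply: (cycle_lens_split lo_inj hi_inj lo_hi lo_hi_cover) => x;
  apply: val_inj; rewrite /= !leaf_permE.
  by rewrite [LHS](leaf_act_left a b (ltn_ord x)) node_chi1 Cab addbb.
by rewrite [LHS](leaf_act_right a b (ltn_ord x)) node_chi1 Cab addbb mul1n.
Qed.

Lemma cycle_lens_node_swap : chi2 a != chi2 b ->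
  perm_eq (cycle_lens (leaf_perm (node a b))) (map double (cycle_lens
    (leaf_perm (a * b)%g))).
Proof.
rewrite negb_eqb leaf_permM ?inE // => Cab.
apply: (cycle_lens_double lo_inj hi_inj lo_hi lo_hi_cover) => x;
  apply: val_inj; rewrite /= !leaf_permE.
  by rewrite [LHS](leaf_act_left a b (ltn_ord x)) node_chi1 Cab mul1n.
by rewrite [LHS](leaf_act_right a b (ltn_ord x)) node_chi1 Cab.
Qed.

End Leaves.

Lemma cycle_lens_leaf (g : typed_aut 0) : cycle_lens (leaf_perm g) = [:: 1%N].
Proof.
have ord_eq (x y : 'I_(2 ^ 0)) : x = y by rewrite (ord1 x) (ord1 y).
have full_orbit x : porbit (leaf_perm g) x = setT.
  by apply/setP=> y; rewrite (ord_eq y x) porbit_id inE.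
have porbits1 : porbits (leaf_perm g) = [set setT].
  apply/setP=> C; rewrite inE; apply/imsetP/eqP=> [[x _ ->]|->];
    first exact: full_orbit.
  by exists ord0; rewrite ?full_orbit.
by rewrite /cycle_lens porbits1 enum_set1 /= cardsT card_ord.
Qed.


Close Scope group_scope.

Section Counting.
Local Open Scope ring_scope.
Import GRing.Theory Num.Theory.

(** * Expectations under the model *)

Definition sizes (p : seq factor) : seq nat := [seq f.2 | f <- p].

(** The expectation of a function F of the parts, D being a distribution on
    products. *)
Definition expect (D : seq datum) (F : seq nat -> rat) : rat :=
  \sum_(pq <- D) pq.2 * F (sizes pq.1).

(** The expectation of F after n steps of the model from the product p. *)
Definition evolve n (p : seq factor) (F : seq nat -> rat) : rat :=
  expect (iter n next_level [:: (p, 1)]) F.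

Lemma expect_iter n D F :
  expect (iter n next_level D) F = \sum_(pq <- D) pq.2 * evolve n pq.1 F.
Proof.
have iter_cat m D1 D2 : iter m next_level (D1 ++ D2) =
    iter m next_level D1 ++ iter m next_level D2.
  by elim: m => [|m IH] //=; rewrite IH /next_level map_cat flatten_cat.
have iter_scale m (c : rat) (D1 : seq datum) :
    iter m next_level [seq (pq.1, c * pq.2) | pq <- D1] =
    [seq (pq.1, c * pq.2) | pq <- iter m next_level D1].
  elim: m => [|m IH] //=; rewrite IH /next_level map_flatten -!map_comp.
  congr flatten; apply: eq_map => -[p q] /=; rewrite -map_comp.
  by apply: eq_map => r /=; rewrite mulrA.
elim: D => [|[p q] D IH].
  have -> : iter n next_level [::] = [::] by elim: n => //= n ->.
  by rewrite /expect !big_nil.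
rewrite -cat1s iter_cat cat1s big_cons -IH /expect big_cat /=; congr (_ + _).
have -> : [:: (p, q)] = [seq (pq.1, q * pq.2) | pq <- [:: (p, 1)]].
  by rewrite /= mulr1.
rewrite iter_scale big_map /evolve /expect mulr_sumr.
by apply: eq_bigr => r _; rewrite mulrA.
Qed.

Lemma evolve0 p F : evolve 0 p F = F (sizes p).
Proof. by rewrite /evolve /expect big_seq1 mul1r. Qed.

Lemma evolveS n p F :
  evolve n.+1 p F = \sum_(r <- next_product p) r.2 * evolve n r.1 F.
Proof.
rewrite /evolve iterSr expect_iter /next_level /= cats0 big_map.
by apply: eq_bigr => r _; rewrite mul1r.
Qed.

Lemma eq_evolve n p F G : F =1 G -> evolve n p F = evolve n p G.
Proof. by move=> eFG; apply: eq_bigr => r _; rewrite eFG. Qed.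

Lemma evolve_sum n p (I : Type) (s : seq I) (c : I -> rat) F :
  evolve n p (fun l => \sum_(i <- s) c i * F i l) =
  \sum_(i <- s) c i * evolve n p (F i).
Proof.
rewrite /evolve /expect; under eq_bigr do rewrite mulr_sumr.
rewrite exchange_big; apply: eq_bigr => i _; rewrite mulr_sumr.
by apply: eq_bigr => r _; rewrite mulrCA.
Qed.

Lemma evolve_exchange n p q (F : seq nat -> seq nat -> rat) :
  evolve n p (fun l => evolve n q (F l)) =
  evolve n q (fun m => evolve n p (F^~ m)).
Proof. by rewrite [LHS]evolve_sum. Qed.

(** Factors are replaced independently. *)
Lemma next_product_cat p q (F : seq factor -> rat) :
  \sum_(r <- next_product (p ++ q)) r.2 * F r.1 =
  \sum_(r <- next_product p) r.2 *
    \sum_(r' <- next_product q) r'.2 * F (r.1 ++ r'.1).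
Proof.
elim: p F => [|f p IH] F; first by rewrite big_seq1 mul1r.
rewrite !big_allpairs_dep; apply: eq_bigr => alt _ /=.
have scale (s : seq datum) (c : rat) (G : datum -> rat) :
    \sum_(r <- s) c * r.2 * G r = c * \sum_(r <- s) r.2 * G r.
  by rewrite mulr_sumr; apply: eq_bigr => r _; rewrite mulrA.
rewrite !scale (IH (fun r => F (alt ++ r))); congr (_ * _).
by apply: eq_bigr => r _; under [in RHS]eq_bigr do rewrite -catA.
Qed.

(** Distinct factors evolve independently. *)
Lemma evolve_cat n p q F :
  evolve n (p ++ q) F = evolve n p (fun l => evolve n q (fun m => F (l ++ m))).
Proof.
elim: n p q F => [|n IH] p q F.
  by rewrite !evolve0 /sizes map_cat.
rewrite !evolveS (next_product_cat p q (fun r => evolve n r F)).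
apply: eq_bigr => r _; congr (_ * _).
under eq_evolve do rewrite evolveS.
rewrite evolve_sum; apply: eq_bigr => r' _; congr (_ * _); exact: IH.
Qed.

Definition perm_invariant (F : seq nat -> rat) :=
  forall l m, perm_eq l m -> F l = F m.

(** Products are commutative, while the lists that encode them are ordered. *)
Lemma evolve_catC n p q F : perm_invariant F ->
  evolve n (p ++ q) F = evolve n (q ++ p) F.
Proof.
move=> FP; rewrite !evolve_cat evolve_exchange; apply: eq_evolve => l.
by apply: eq_evolve => m; apply: FP; rewrite perm_catC.
Qed.

Definition double_factor (f : factor) : factor := (f.1, f.2.*2).

Lemma next_product_double p : next_product (map double_factor p) =
  [seq (map double_factor r.1, r.2) | r <- next_product p].
Proof.
elim: p => [|f p IH] //=; rewrite IH map_allpairs.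
have -> : alternatives (double_factor f) =
  map (map double_factor) (alternatives f).
  by case: f => [[] d].
by rewrite size_map allpairs_mapl allpairs_mapr; apply: eq_allpairs => a b /=;
  rewrite map_cat.
Qed.

Lemma evolve_double n p F :
  evolve n (map double_factor p) F = evolve n p (fun l => F (map double l)).
Proof.
elim: n p F => [|n IH] p F.
  by rewrite !evolve0 /sizes -!map_comp.
rewrite !evolveS next_product_double big_map.
by apply: eq_bigr => r _; rewrite IH.
Qed.

(** * Counting automorphisms by type *)

(** The letter n is true, as for [chi1] and [chi2]. *)
Definition type_of_chars (a b : bool) : ctype :=
  match a, b with
  | true, true => nn | true, false => ns | false, true => sn | false, false => ss
  end.

Definition has_type n (a b : bool) (g : typed_aut n) :=
  (chi1 g == a) && (chi2 g == b).

(** The common number of elements of each type. *)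
Fixpoint class_size n : rat :=
  if n is n'.+1 then 4%:R * class_size n' ^+ 2 else 1.

Lemma sum_node n (P : pred (typed_aut n.+1)) (F : typed_aut n.+1 -> rat) :
  \sum_(g | P g) F g = \sum_a \sum_(b | P (node a b)) F (node a b).
Proof.
rewrite pair_big_dep (reindex (fun p : typed_aut n * typed_aut n =>
  node p.1 p.2)) //=.
by exists id => -[a b].
Qed.

Lemma sum_by_type n (F : typed_aut n -> rat) :
  \sum_g F g = \sum_a \sum_b \sum_(g | has_type a b g) F g.
Proof.
rewrite (partition_big (@chi1 (typed_aut n)) predT) //=; apply: eq_bigr => a _.
by rewrite (partition_big (@chi2 (typed_aut n)) predT).
Qed.

(** The types of the two halves of an element of given type add up to a fixed
    type, so one half is arbitrary and determines the type of the other. *)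
Lemma card_type n a b : \sum_(g : typed_aut n | has_type a b g) 1 = class_size n.
Proof.
elim: n a b => [|n IH] a b.
  by rewrite (big_pred1 ((a, b) : klein)) // => -[c d].
rewrite sum_node /=.
have inner (x : typed_aut n) :
    \sum_(y : typed_aut n | has_type a b (node x y)) 1 = class_size n.
  rewrite -(IH (b (+) chi1 x) (a (+) chi2 x)); apply: eq_bigl => y.
  rewrite /has_type node_chi1 node_chi2 andbC.
  by case: (chi1 x) (chi1 y) (chi2 x) (chi2 y) a b => [] [] [] [] [] [].
under eq_bigr do rewrite inner -[class_size n]mulr1.
rewrite -mulr_sumr sum_by_type.
under eq_bigr do under eq_bigr do rewrite IH.
rewrite !big_bool /=; ring.
Qed.

(** By induction from the root, for all F at once. The function F enters with
    the cycles of one half already appended (when the halves are preserved) or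
    with doubled parts (when they are exchanged); in the second case the
    substitution h = x y makes h uniform and independent of x. *)
Lemma sum_type_cycle_lens n a b F : perm_invariant F ->
  \sum_(g : typed_aut n | has_type a b g) F (cycle_lens (leaf_perm g)) =
  class_size n * evolve n [:: (type_of_chars a b, 1%N)] F.
Proof.
elim: n a b F => [|n IH] a b F FP.
  under eq_bigr do rewrite cycle_lens_leaf -[F _]mulr1.
  by rewrite -mulr_sumr card_type evolve0 mulrC.
rewrite sum_node; case: a.
  (* The halves are exchanged. *)
  have step (x : typed_aut n) :
      \sum_(y | has_type true b (node x y))
        F (cycle_lens (leaf_perm (node x y))) =
      class_size n * evolve n [:: (type_of_chars b true, 1%N)]
                       (fun l => F (map double l)).
    rewrite -IH; last by move=> l m lm; apply: FP; apply: perm_map.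
    rewrite (reindex_inj (mulgI x^-1%g)) /=.
    apply: eq_big => [h|h].
      rewrite /has_type node_chi1 node_chi2 chi1M chi2M chi1V chi2V.
      by rewrite !addbA !addbb andbC.
    rewrite /has_type node_chi1 => /andP[/eqP Ch _]; apply: FP.
    have Cx : chi2 x != chi2 (x^-1 * h)%g by rewrite negb_eqb Ch.
    by apply: perm_trans (cycle_lens_node_swap Cx) _; rewrite mulKVg.
  under eq_bigr do rewrite step -[class_size n]mul1r -mulrA.
  rewrite -mulr_suml sum_by_type.
  under eq_bigr do under eq_bigr do rewrite card_type.
  rewrite !big_bool -(evolve_double _ [:: _]) evolveS.
  by case: b {step}; rewrite /next_product /= !big_seq1 /=; field.
(* The halves are preserved. *)
have step (x : typed_aut n) :
    \sum_(y | has_type false b (node x y))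
      F (cycle_lens (leaf_perm (node x y))) =
    class_size n * evolve n [:: (type_of_chars (b (+) chi1 x) (chi2 x), 1%N)]
                     (fun l => F (cycle_lens (leaf_perm x) ++ l)).
  rewrite -IH; last by move=> l m lm; apply: FP; rewrite perm_cat2l.
  apply: eq_big => [y|y].
    rewrite /has_type node_chi1 node_chi2 andbC.
    by case: (chi1 x) (chi1 y) (chi2 x) (chi2 y) b => [] [] [] [] [].
  rewrite /has_type node_chi1 => /andP[/eqP Cy _]; apply: FP.
  by apply: cycle_lens_node_fix; case: (chi2 x) (chi2 y) Cy => [] [].
under eq_bigr do rewrite step.
rewrite -mulr_sumr sum_by_type.
have class c d : \sum_(x : typed_aut n | has_type c d x)
      evolve n [:: (type_of_chars (b (+) chi1 x) (chi2 x), 1%N)]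
        (fun l => F (cycle_lens (leaf_perm x) ++ l)) =
    class_size n * evolve n [:: (type_of_chars c d, 1%N);
                                (type_of_chars (b (+) c) d, 1%N)] F.
  rewrite -cat1s evolve_cat -IH; last first.
    move=> l m lm; apply: eq_evolve => l'; apply: FP; by rewrite perm_cat2r.
  by apply: eq_bigr => x /andP[/eqP-> /eqP->].
under eq_bigr do under eq_bigr do rewrite class.
rewrite !big_bool evolveS; case: b {step class} => /=.
  rewrite /next_product /= !big_cons big_nil /=.
  (* The four ordered pairs of types give each alternative for sn twice. *)
  rewrite (evolve_catC n [:: (ss, _)] [:: (ns, _)] FP).
  rewrite (evolve_catC n [:: (sn, _)] [:: (nn, _)] FP) /=; by field.
by rewrite /next_product /= !big_cons big_nil /=; field.
Qed.

Lemma sum_cycle_lens n F : perm_invariant F ->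
  \sum_(g : typed_aut n.+1) F (cycle_lens (leaf_perm g)) =
  #|typed_aut n.+1|%:R * expect (model5_level n.+1) F.
Proof.
move=> FP; rewrite sum_by_type.
under eq_bigr do under eq_bigr do rewrite sum_type_cycle_lens //.
have -> : #|typed_aut n.+1|%:R = 4%:R * class_size n.+1.
  rewrite -sum1_card natr_sum sum_by_type.
  under eq_bigr do under eq_bigr do rewrite card_type.
  rewrite !big_bool /=; ring.
rewrite expect_iter !big_bool !evolveS /next_product /= !big_cons !big_nil /=.
by field.
Qed.

Lemma is_partition_perm N la l : is_partition N la ->
  (sort geq l == la) = perm_eq l la.
Proof.
case/and3P=> la_sorted _ _; apply/eqP/idP=> [<-|l_la].
  by rewrite perm_sym perm_sort.
apply: (@sorted_eq _ geq) => //.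
- by move=> x y z /= xy yz; apply: leq_trans yz xy.
- by move=> x y /=; rewrite andbC -eqn_leq => /eqP.
- by apply: sort_sorted => x y; apply: leq_total.
- by rewrite perm_sort.
Qed.

(** Every fibre is a coset of the kernel. *)
Lemma sum_morphim (gT rT : finGroupType) (f : {morphism [set: gT] >-> rT})
    (F : rT -> rat) :
  \sum_(g : gT) F (f g) = #|('ker f)%g|%:R * \sum_(s in (f @* [set: gT])%g) F s.
Proof.
rewrite (partition_big f (mem (f @* [set: gT])%g)) /=; last first.
  by move=> g _; rewrite mem_morphim ?inE.
rewrite mulr_sumr; apply: eq_bigr => _ /morphimP[g0 _ _ ->].
rewrite (eq_bigl (mem ('ker f :* g0)%g)); last first.
  by move=> g; apply/eqP/rcoset_kerP; rewrite ?inE.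
rewrite (eq_bigr (fun=> F (f g0))); last by move=> g /rcoset_kerP->; rewrite ?inE.
by rewrite sumr_const card_rcoset mulr_natl.
Qed.

Lemma proportion_morphim (gT : finGroupType) (T : finType)
    (f : {morphism [set: gT] >-> {perm T}}) la :
  proportion (f @* [set: gT])%G la =
  (\sum_(g : gT) (cycle_type (f g) == la)%:R) / #|gT|%:R.
Proof.
have ker_neq0 : #|('ker f)%g|%:R != 0 :> rat by rewrite pnatr_eq0 -lt0n cardG_gt0.
rewrite (sum_morphim f (fun s => (cycle_type s == la)%:R)).
have -> : #|gT|%:R = #|('ker f)%g|%:R * #|(f @* [set: gT])%g|%:R :> rat.
  have := sum_morphim f (fun=> 1); rewrite !sumr_const => <-.
  by congr _%:R; apply: eq_card => g.
rewrite -mulf_div divff // mul1r /proportion; congr (_ / _).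
rewrite -natr_sum; congr _%:R.
rewrite -sum1_card big_mkcond [RHS]big_mkcond; apply: eq_bigr => s _.
by rewrite inE; case: (s \in _) => //=; case: eqP.
Qed.

Lemma proportion_image n la : is_partition (2 ^ n.+1) la ->
  proportion (@leaf_perm n.+1 @* [set: typed_aut n.+1])%G la =
  model5_density n.+1 la.
Proof.
move=> la_part; rewrite proportion_morphim.
pose F l : rat := (perm_eq l la)%:R.
have FP : perm_invariant F by move=> l m lm; rewrite /F (permPl lm).
rewrite (eq_bigr (fun g => F (cycle_lens (leaf_perm g)))); last first.
  by move=> g _; rewrite /F /cycle_type (is_partition_perm _ la_part).
rewrite sum_cycle_lens // mulrAC divff ?mul1r; last first.
  by rewrite pnatr_eq0 -lt0n; apply/card_gt0P; exists 1%g.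
rewrite /model5_density [RHS]big_mkcond; apply: eq_bigr => pq _ /=.
by rewrite /F /sizes; case: (perm_eq _ _); rewrite ?mulr1 ?mulr0.
Qed.

End Counting.

Theorem theoremC (n : nat) (hn : 1 <= n) :
  M_group n \subset W_group n /\
  (forall la : seq nat, is_partition (2 ^ n) la ->
     proportion (M_group n) la = model5_density n la).
Proof.
have M_image : M_group n = (@leaf_perm n @* [set: typed_aut n])%G.
  by apply/group_inj/M_group_image.
split=> [|la la_part]; rewrite M_image.
  by apply/subsetP=> _ /morphimP[g _ _ ->]; apply: leaf_perm_W.
by case: n hn la_part {M_image} => // n _; apply: proportion_image.
Qed.
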